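(* Let $p$ be an odd prime, $n$ a positive integer, and let $E$ be an ordinary elliptic curve over $\mathbb{F}_{p^n}$ whose endomorphism ring $R$ is a maximal order of an imaginary quadratic field $K=\mathbb{Q}(\sqrt{D})$, $D<0$. Let $\alpha$ be an endomorphism of $E$ defined over $\mathbb{F}_{p^n}$, of prime degree $l$ coprime to the discriminant of $K$, whose kernel contains points of $E(\mathbb{F}_{p^n})$, written as $\alpha(x,y)=(r(x),\,y\cdot s(x))$ with $r,s\in\mathbb{F}_{p^n}(x)$. Let $d$ be a positive integer, $q=p^{2nd}$, $\pi_{p^n}$ the $p^n$-Frobenius endomorphism of $E$, $\rho=\pi_{p^n}^{2d}$, $\delta_0=\rho$, and let $k_0=\nu_\alpha(\delta_0-1)$. Let $G^q_r$ be the functional graph of $r$ on $\mathbb{P}^1(\mathbb{F}_q)$. If $T^q_r(\tilde x)$ is a tree of $G^q_r$ rooted in $\tilde x\in\mathbb{P}^1(\mathbb{F}_{p^{nd}})$, then $T^q_r(\tilde x)$ has depth $k_0$ and every leaf of $T^q_r(\tilde x)$ has height $k_0$.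
   Context: All elements of $R$ (in particular $\alpha$, $\pi_{p^n}$, $\rho$, $\delta_0$) are identified with their images in $R$. For a nonzero $\beta\in R$, $\nu_\alpha(\beta)$ denotes the exponent of the greatest power of $\alpha$ dividing $\beta$ in $R$, i.e. $\beta=\alpha^{k}\gamma$ with $\gamma\in R$ coprime to $\alpha$; in this setting $k_0=\nu_\alpha(\delta_0-1)$ is a positive integer. The graph $G^q_r$ has vertex set $\mathbb{P}^1(\mathbb{F}_q)=\mathbb{F}_q\cup\{\infty\}$, with a directed edge from $x_1$ to $x_2$ whenever $x_2=r(x_1)$. Each connected component contains exactly one cycle, and a tree is attached to each vertex of the cycle: the tree $T^q_r(\tilde x)$ rooted in an $r$-periodic vertex $\tilde x$ consists of $\tilde x$ together with the non-periodic vertices whose forward orbit first enters the cycle at $\tilde x$. The height of a vertex $x$ of the tree is the least $m\ge 0$ with $r^m(x)=\tilde x$; the depth of the tree is the maximal height of its vertices; a leaf is a vertex of the tree with no preimage under $r$ in $\mathbb{P}^1(\mathbb{F}_q)$. *)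

(* Defs.v *)
From HB Require Import structures.
From mathcomp Require Import all_boot all_order all_algebra all_field.

Set Implicit Arguments.
Unset Strict Implicit.
Unset Printing Implicit Defensive.

Import GRing.Theory.
Local Open Scope ring_scope.

(** * Orders of number fields *)

Section NumberFields.
Variable K : fieldExtType rat.

Definition Zbasis (O : K -> Prop) (w : (\dim {:K}).-tuple K) : Prop :=
  basis_of fullv w /\
  forall x, O x <-> exists c : 'I_(\dim {:K}) -> int,
                      x = \sum_i (c i)%:~R * tnth w i.

(* Stability under subtraction is part of being the Z-span of a basis. *)
Definition is_order (O : K -> Prop) : Prop :=
  [/\ O 1, forall x y, O x -> O y -> O (x * y) & exists w, Zbasis O w].

Definition maximal_order (O : K -> Prop) : Prop :=
  is_order O /\
  forall O' : K -> Prop,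
    is_order O' -> (forall x, O x -> O' x) -> forall x, O' x -> O x.

Definition field_trace (x : K) : rat :=
  \tr (passmx.mxof (vbasis {:K}) (vbasis {:K}) (amull x)).

Definition is_discriminant (dK : int) : Prop :=
  exists O w, [/\ maximal_order O, Zbasis O w &
    dK%:~R = \det (\matrix_(i, j) field_trace (tnth w i * tnth w j))].

End NumberFields.

(* L is an algebraic closure of the prime field with p elements. *)
Definition alg_closure_Fp (p : nat) (L : closedFieldType) : Prop :=
  p \in [pchar L] /\ forall x : L, exists2 m, (0 < m)%N & x ^+ (p ^ m) = x.

(** * Finite subfields, projective lines and rational functions *)

Section RationalFunctions.
Variable L : fieldType.

(* For L as above and q a power of p, this is the subfield of L of order q. *)
Definition Fq (q : nat) : {pred L} := [pred x | x ^+ q == x].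

(* The projective line over L; None is the point at infinity. *)
Definition P1 : Type := option L.

Definition P1q (q : nat) : {pred P1} :=
  [pred u | if u is Some x then x \in Fq q else true].

Record ratfun := RatFun {
  rnum : {poly L};
  rden : {poly L};
  rden_neq0 : rden != 0;
  rnum_rden_coprime : coprimep rnum rden
}.

Definition ratfun_over (q : nat) (r : ratfun) : Prop :=
  rnum r \is a polyOver (Fq q) /\ rden r \is a polyOver (Fq q).

Definition ratfun_degree (r : ratfun) : nat :=
  maxn (size (rnum r)).-1 (size (rden r)).-1.

(* At infinity: if deg num <= deg den, the value is the quotient of the
   coefficients of degree deg den, which is 0 when deg num < deg den. *)
Definition ratfun_eval (r : ratfun) (u : P1) : P1 :=
  match u with
  | Some x => if (rden r).[x] == 0 then None
              else Some ((rnum r).[x] / (rden r).[x])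
  | None => if (size (rden r) < size (rnum r))%N then None
            else Some ((rnum r)`_(size (rden r)).-1 / lead_coef (rden r))
  end.

End RationalFunctions.

(** * Elliptic curves in odd characteristic *)

Section EllipticCurves.
Variable L : fieldType.

Definition cubic (a2 a4 a6 : L) : {poly L} :=
  'X^3 + a2 *: 'X^2 + a4 *: 'X + a6%:P.

(* y^2 = x^3 + a2 x^2 + a4 x + a6.  The quadratic term cannot be removed in
   characteristic 3.  In odd characteristic, the curve is smooth if and only
   if the cubic is separable. *)
Record ecurve := ECurve {
  ec_a2 : L;
  ec_a4 : L;
  ec_a6 : L;
  ec_smooth : separable_poly (cubic ec_a2 ec_a4 ec_a6)
}.

Implicit Types (E : ecurve).

Definition ec_over (q : nat) E : Prop :=
  [/\ ec_a2 E \in Fq q, ec_a4 E \in Fq q & ec_a6 E \in Fq q].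

(* Affine points, and None for the point O at infinity. *)
Definition point : Type := option (L * L).

Definition on_curve E : {pred point} :=
  [pred P | if P is Some (x, y)
            then y ^+ 2 == (cubic (ec_a2 E) (ec_a4 E) (ec_a6 E)).[x]
            else true].

Definition rational_point (q : nat) : {pred point} :=
  [pred P | if P is Some (x, y) then (x \in Fq q) && (y \in Fq q)
            else true].

Definition ec_opp (P : point) : point :=
  if P is Some (x, y) then Some (x, - y) else None.

Definition ec_add E (P Q : point) : point :=
  match P, Q with
  | None, _ => Q
  | _, None => P
  | Some (x1, y1), Some (x2, y2) =>
      if (x1 == x2) && (y1 + y2 == 0) then None else
      let m := if x1 == x2
               then (3%:R * x1 ^+ 2 + 2%:R * ec_a2 E * x1 + ec_a4 E)
                      / (2%:R * y1)
               else (y2 - y1) / (x2 - x1) in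
      let x3 := m ^+ 2 - ec_a2 E - x1 - x2 in
      Some (x3, m * (x1 - x3) - y1)
  end.

Definition ec_muln E (m : nat) (P : point) : point := iter m (ec_add E P) None.

(* p is the characteristic and L is algebraically closed: E[p] <> {O}. *)
Definition ordinary (p : nat) E : Prop :=
  exists P, [/\ P \in on_curve E, P <> None & ec_muln E p P = None].

(** * Endomorphisms *)

(* Polynomials in two variables are elements of {poly {poly L}}.  A fraction
   A / B is a rational function on the curve when B does not vanish
   identically on it; phi has to agree with (A1 / B1, A2 / B2) wherever both
   denominators are nonzero. *)
Definition given_by_rational_functions E (phi : point -> point) : Prop :=
  exists A1 B1 A2 B2 : {poly {poly L}},
  [/\ exists x y, Some (x, y) \in on_curve E /\ B1.[x%:P].[y] != 0,
      exists x y, Some (x, y) \in on_curve E /\ B2.[x%:P].[y] != 0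
    & forall x y, Some (x, y) \in on_curve E ->
        B1.[x%:P].[y] != 0 -> B2.[x%:P].[y] != 0 ->
        phi (Some (x, y)) = Some (A1.[x%:P].[y] / B1.[x%:P].[y],
                                  A2.[x%:P].[y] / B2.[x%:P].[y])].

(* For L algebraically closed: the group homomorphisms E(L) -> E(L) that are
   given by rational functions, and the zero map.  Only the restriction of
   phi to the points of E is meaningful, so endomorphisms have to be compared
   by {in on_curve E, phi =1 psi}. *)
Definition endomorphism E (phi : point -> point) : Prop :=
  [/\ {homo phi : P / P \in on_curve E},
      {in on_curve E &, {morph phi : P Q / ec_add E P Q}}
    & {in on_curve E, phi =1 fun=> None} \/ given_by_rational_functions E phi].

Definition end_add E (phi psi : point -> point) : point -> point :=
  fun P => ec_add E (phi P) (psi P).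

Definition end_sub E (phi psi : point -> point) : point -> point :=
  fun P => ec_add E (phi P) (ec_opp (psi P)).

Definition frobenius (q : nat) (P : point) : point :=
  if P is Some (x, y) then Some (x ^+ q, y ^+ q) else None.

(* The formula is read on P^1: the image is O where r or s has a pole. *)
Definition standard_form E (phi : point -> point) (r s : ratfun L) : Prop :=
  forall x y, Some (x, y) \in on_curve E ->
    phi (Some (x, y)) =
      if (ratfun_eval r (Some x), ratfun_eval s (Some x))
           is (Some x', Some s') then Some (x', y * s') else None.

(* theta is a ring isomorphism from O onto the ring End(E), whose addition is
   pointwise and whose multiplication is composition. *)
Definition End_isomorphic E (K : nzRingType) (O : K -> Prop) : Prop :=
  exists theta : K -> point -> point,
  [/\ forall a, O a -> endomorphism E (theta a),
      forall phi, endomorphism E phi ->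
        exists a, O a /\ {in on_curve E, theta a =1 phi},
      forall a b, O a -> O b -> {in on_curve E, theta a =1 theta b} -> a = b
    & [/\ {in on_curve E, theta 1 =1 id},
          forall a b, O a -> O b ->
            {in on_curve E, theta (a + b) =1 end_add E (theta a) (theta b)}
        & forall a b, O a -> O b ->
            {in on_curve E, theta (a * b) =1 theta a \o theta b}]].

Definition end_dvd E (alpha beta : point -> point) : Prop :=
  exists gamma, endomorphism E gamma /\
                {in on_curve E, beta =1 alpha \o gamma}.

Definition end_valuation E (alpha beta : point -> point) (k : nat) : Prop :=
  end_dvd E (iter k alpha) beta /\
  forall j, end_dvd E (iter j alpha) beta -> (j <= k)%N.

End EllipticCurves.

(** * Trees of a functional graph *)

Section Trees.
Variables (T : eqType) (V : {pred T}) (f : T -> T).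

Definition periodic (x : T) : Prop := exists2 m, (0 < m)%N & iter m f x = x.

Definition in_tree (root x : T) : Prop :=
  x \in V /\
  (x = root \/
   ~ periodic x /\
   exists m, iter m f x = root /\
             forall j, (j < m)%N -> ~ periodic (iter j f x)).

Definition height (root x : T) (m : nat) : Prop :=
  iter m f x = root /\ forall j, (j < m)%N -> iter j f x <> root.

Definition tree_depth (root : T) (k : nat) : Prop :=
  (exists x, in_tree root x /\ height root x k) /\
  forall x m, in_tree root x -> height root x m -> (m <= k)%N.

Definition tree_leaf (root x : T) : Prop :=
  in_tree root x /\ forall y, y \in V -> f y <> x.

End Trees.

(* Main.v *)
Require Import Defs.
From HB Require Import structures.
From mathcomp Require Import all_boot all_order all_algebra all_field.
From mathcomp Require Import ring lra zify.
Import GRing.Theory.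
Local Open Scope ring_scope.
Set Implicit Arguments.
Unset Strict Implicit.
Unset Printing Implicit Defensive.

(* The abscissa identifies P^1 with E(L) up to sign and turns r into alpha and
   the q-power map into rho.  A vertex of the tree is the abscissa of a sum
   P1 + P2 with P1 killed by a power of alpha and P2 periodic under alpha, and
   its height is the least m with alpha^m P1 = 0.  Write rho - 1 = alpha^k0 gamma
   with alpha not dividing gamma.  The kernel of alpha has prime order l, so
   gamma is injective on it: otherwise gamma kills the kernel and factors
   through alpha.  Hence the alpha-nilpotent points fixed by rho are exactly
   those of ker alpha^k0; as alpha is surjective, each of them with m < k0 is
   the image of another one, so that all leaves have height k0.

   A priori rho P = - P may occur above a vertex.  Then alpha P1 = 0 and rho
   fixes P1 after all: otherwise a point of order 2 lies in ker alpha^2 but not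
   in ker alpha, which forces l = 2 and makes alpha^2 divide 2 with a unit
   quotient, i.e. 2 ramifies in K, against the coprimality of l and the
   discriminant.

   The factorization through alpha is elementary: an endomorphism vanishing on
   ker alpha is constant on the fibres of r, and reduction modulo
   N(X) - u M(X), where r = N / M, expresses it through u = r(x). *)


(** * The group law *)

Section GroupLaw.
Variables (F : fieldType) (E : ecurve F).
Hypothesis two_neq0 : 2%:R != 0 :> F.
Implicit Types (P Q R A B C T : point F) (x y m k : F).

Local Notation a2 := (ec_a2 E).
Local Notation a4 := (ec_a4 E).
Local Notation a6 := (ec_a6 E).
Local Notation "P \+e Q" := (ec_add E P Q) (at level 50, left associativity).

Lemma horner_cubic b c e x :
  (cubic b c e : {poly F}).[x] = x ^+ 3 + b * x ^+ 2 + c * x + e.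
Proof. by rewrite /cubic !hornerE. Qed.

Lemma horner_deriv_cubic b c e x :
  (cubic b c e : {poly F})^`().[x] = 3%:R * x ^+ 2 + 2%:R * b * x + c.
Proof.
rewrite /cubic !derivE !hornerE /=; ring.
Qed.

Lemma on_curveE x y :
  (Some (x, y) \in on_curve E) = (y ^+ 2 == x ^+ 3 + a2 * x ^+ 2 + a4 * x + a6).
Proof. by rewrite inE horner_cubic. Qed.

Lemma on_curve_x x y y' :
  Some (x, y) \in on_curve E -> Some (x, y') \in on_curve E ->
  y' = y \/ y' = - y.
Proof.
rewrite !on_curveE => /eqP <-; rewrite eqf_sqr.
by case/orP => /eqP ->; [left | right].
Qed.

Lemma cubic_simple_root x :
  x ^+ 3 + a2 * x ^+ 2 + a4 * x + a6 = 0 ->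
  3%:R * x ^+ 2 + 2%:R * a2 * x + a4 != 0.
Proof.
have := ec_smooth E; rewrite separable_poly.unlock => sepE r0.
have := coprimep_root sepE (x := x).
by rewrite horner_deriv_cubic rootE horner_cubic r0; apply.
Qed.

(* The line y = m x + k meets the curve in abscissas x1, x2, x3, i.e.
   f(X) - (m X + k)^2 = (X - x1) (X - x2) (X - x3). *)
Definition chord x1 x2 x3 m k : Prop :=
  [/\ a2 = m ^+ 2 - x1 - x2 - x3,
      a4 = 2%:R * m * k + x1 * x2 + x1 * x3 + x2 * x3
    & a6 = k ^+ 2 - x1 * x2 * x3].

Lemma chord_rot x1 x2 x3 m k : chord x1 x2 x3 m k -> chord x2 x3 x1 m k.
Proof. by case=> e2 e4 e6; split; rewrite ?e2 ?e4 ?e6; ring. Qed.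

Lemma chord_swap x1 x2 x3 m k : chord x1 x2 x3 m k -> chord x2 x1 x3 m k.
Proof. by case=> e2 e4 e6; split; rewrite ?e2 ?e4 ?e6; ring. Qed.

Lemma chord_opp x1 x2 x3 m k : chord x1 x2 x3 m k -> chord x1 x2 x3 (- m) (- k).
Proof. by case=> e2 e4 e6; split; rewrite ?e2 ?e4 ?e6; ring. Qed.

Lemma chord_on_curve x1 x2 x3 m k :
  chord x1 x2 x3 m k -> Some (x1, m * x1 + k) \in on_curve E.
Proof. by case=> e2 e4 e6; rewrite on_curveE e2 e4 e6; apply/eqP; ring. Qed.

Lemma chord_add x1 x2 x3 m k : chord x1 x2 x3 m k ->
  Some (x1, m * x1 + k) \+e Some (x2, m * x2 + k) = Some (x3, - (m * x3 + k)).
Proof.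
move=> ch; case: (ch) => e2 e4 e6; rewrite /ec_add.
have [e12|n12] /= := eqVneq x1 x2; last first.
  have n21 : x2 - x1 != 0 by rewrite subr_eq0 eq_sym.
  have -> : (m * x2 + k - (m * x1 + k)) / (x2 - x1) = m by field.
  by rewrite e2; congr (Some (_, _)); ring.
subst x2; have -> : m * x1 + k + (m * x1 + k) = 2%:R * (m * x1 + k) by ring.
rewrite mulf_eq0 (negPf two_neq0) /=.
case: eqP => [y0|/eqP y0]; last first.
  have -> : (3%:R * x1 ^+ 2 + 2%:R * a2 * x1 + a4) / (2%:R * (m * x1 + k)) = m.
    by rewrite e2 e4; field; rewrite two_neq0 y0.
  by rewrite e2; congr (Some (_, _)); ring.
have ek : k = - (m * x1) by apply/eqP; rewrite -subr_eq0 opprK addrC y0.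
have := @cubic_simple_root x1; rewrite e2 e4 e6 ek => /(_ _)/eqP[]; ring.
Qed.

Lemma add_chord x1 y1 x2 y2 :
  Some (x1, y1) \in on_curve E -> Some (x2, y2) \in on_curve E ->
  ~~ ((x1 == x2) && (y1 + y2 == 0)) ->
  exists x3 m k, [/\ chord x1 x2 x3 m k, y1 = m * x1 + k & y2 = m * x2 + k].
Proof.
rewrite !on_curveE => /eqP c1 /eqP c2.
have e6 : a6 = y1 ^+ 2 - (x1 ^+ 3 + a2 * x1 ^+ 2 + a4 * x1) by rewrite c1; ring.
have [e12|n12] /= := eqVneq x1 x2 => [y12|_]; last first.
  have n21 : x2 - x1 != 0 by rewrite subr_eq0 eq_sym.
  have e4 : a4 = (y2 ^+ 2 - y1 ^+ 2 - (x2 ^+ 3 - x1 ^+ 3)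
                  - a2 * (x2 ^+ 2 - x1 ^+ 2)) / (x2 - x1).
    by rewrite c1 c2; field.
  pose m := (y2 - y1) / (x2 - x1).
  exists (m ^+ 2 - a2 - x1 - x2), m, (y1 - m * x1); split; last 2 first.
  - by ring.
  - by rewrite /m; field.
  by split; [ring | rewrite e4 /m; field | rewrite e6 e4 /m; field].
subst x2; have y0 : y1 = y2.
  have/eqP : y1 ^+ 2 = y2 ^+ 2 by rewrite c1 c2.
  by rewrite eqf_sqr => /orP[/eqP-> // | /eqP y1E]; rewrite y1E addNr eqxx in y12.
subst y2; have y10 : y1 != 0 by apply: contraNneq y12 => ->; rewrite addr0.
pose m := (3%:R * x1 ^+ 2 + 2%:R * a2 * x1 + a4) / (2%:R * y1).
have e4 : a4 = 2%:R * m * y1 - 3%:R * x1 ^+ 2 - 2%:R * a2 * x1.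
  by rewrite /m; field; rewrite two_neq0 y10.
exists (m ^+ 2 - a2 - x1 - x1), m, (y1 - m * x1).
split; [split | by ring | by ring]; first by ring.
  by rewrite e4 /m; field; rewrite two_neq0 y10.
by rewrite e6 e4; ring.
Qed.

Definition sum0 P Q R : Prop :=
  [\/ P = None /\ R = ec_opp Q, Q = None /\ R = ec_opp P,
      R = None /\ Q = ec_opp P
    | exists x1 x2 x3 m k, [/\ chord x1 x2 x3 m k, P = Some (x1, m * x1 + k),
        Q = Some (x2, m * x2 + k) & R = Some (x3, m * x3 + k)]].

Lemma ec_oppK : involutive (@ec_opp F).
Proof. by case=> [[x y]|] //=; rewrite opprK. Qed.

Lemma ec_opp_curve P : (ec_opp P \in on_curve E) = (P \in on_curve E).
Proof. by case: P => [[x y]|] //=; rewrite !on_curveE sqrrN. Qed.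

Lemma ec_addr0 P : P \+e None = P. Proof. by case: P => [[]|]. Qed.

Lemma ec_addN P : P \+e ec_opp P = None.
Proof. by case: P => [[x y]|] //=; rewrite eqxx subrr eqxx. Qed.

Lemma ec_addP P Q : P \in on_curve E -> Q \in on_curve E ->
  sum0 P Q (ec_opp (P \+e Q)).
Proof.
case: P => [[x1 y1]|]; last by constructor 1.
case: Q => [[x2 y2]|] cP cQ; last by constructor 2.
case: (boolP ((x1 == x2) && (y1 + y2 == 0))) => [/andP[/eqP e12 y12]|nPQ].
  constructor 3; rewrite e12 /= eqxx y12; split=> //.
  by congr (Some (_, _)); apply/eqP; rewrite -addr_eq0 addrC.
constructor 4; have [x3 [m [k [ch -> ->]]]] := add_chord cP cQ nPQ.
exists x1, x2, x3, m, k; split => //.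
by rewrite (chord_add ch) /= opprK.
Qed.

Lemma sum0_add P Q R : sum0 P Q R -> P \+e Q = ec_opp R.
Proof.
case=> [[-> ->]|[-> ->]|[-> ->]|].
- by rewrite ec_oppK.
- by rewrite ec_addr0 ec_oppK.
- exact: ec_addN.
by move=> [x1 [x2 [x3 [m [k [ch -> -> ->]]]]]]; rewrite (chord_add ch).
Qed.

Lemma sum0_rot P Q R : sum0 P Q R -> sum0 Q R P.
Proof.
case=> [[-> ->]|[-> ->]|[-> ->]|].
- by constructor 3.
- by constructor 1; rewrite ec_oppK.
- by constructor 2; rewrite ec_oppK.
move=> [x1 [x2 [x3 [m [k [ch -> -> ->]]]]]]; constructor 4.
by exists x2, x3, x1, m, k; split => //; apply: chord_rot.
Qed.

Lemma sum0_swap P Q R : sum0 P Q R -> sum0 Q P R.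
Proof.
case=> [[-> ->]|[-> ->]|[-> ->]|].
- by constructor 2.
- by constructor 1.
- by constructor 3; rewrite ec_oppK.
move=> [x1 [x2 [x3 [m [k [ch -> -> ->]]]]]]; constructor 4.
by exists x2, x1, x3, m, k; split => //; apply: chord_swap.
Qed.

Lemma sum0_opp P Q R : sum0 P Q R -> sum0 (ec_opp P) (ec_opp Q) (ec_opp R).
Proof.
case=> [[-> ->]|[-> ->]|[-> ->]|].
- by constructor 1.
- by constructor 2.
- by constructor 3.
move=> [x1 [x2 [x3 [m [k [ch -> -> ->]]]]]]; constructor 4.
exists x1, x2, x3, (- m), (- k); rewrite /= !opprD !mulNr; split => //.
exact: chord_opp.
Qed.

Lemma sum0_curve P Q R : P \in on_curve E -> Q \in on_curve E ->
  sum0 P Q R -> R \in on_curve E.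
Proof.
move=> cP cQ [[_ ->]|[_ ->]|[-> _]|]; rewrite ?ec_opp_curve //.
move=> [x1 [x2 [x3 [m [k [ch _ _ ->]]]]]].
by apply: chord_on_curve (chord_rot (chord_rot ch)).
Qed.

Lemma ec_add_curve P Q : P \in on_curve E -> Q \in on_curve E ->
  P \+e Q \in on_curve E.
Proof.
by move=> cP cQ; rewrite -ec_opp_curve; apply: sum0_curve (ec_addP cP cQ).
Qed.

Lemma ec_addC P Q : P \in on_curve E -> Q \in on_curve E ->
  P \+e Q = Q \+e P.
Proof.
by move=> cP cQ; rewrite (sum0_add (sum0_swap (ec_addP cP cQ))) ec_oppK.
Qed.

Lemma ec_addK P Q : P \in on_curve E -> Q \in on_curve E ->
  (P \+e Q) \+e ec_opp P = Q.
Proof.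
move=> cP cQ.
have := sum0_add (sum0_rot (sum0_rot (sum0_opp (ec_addP cP cQ)))).
by rewrite !ec_oppK.
Qed.

Lemma ec_addI P Q R : P \in on_curve E -> Q \in on_curve E ->
  R \in on_curve E -> P \+e Q = P \+e R -> Q = R.
Proof. by move=> cP cQ cR e; rewrite -(ec_addK cP cQ) e ec_addK. Qed.


(* In the coordinate y - (m x + k), which vanishes at A and B, the curve reads
   Y^2 + 2 (m x + k) Y = (x - x1) (x - x2) (x - x3); solving the equation of
   T = (t, Y) for k leaves a rational identity without side relations. *)
Lemma chord_assoc x1 x2 x3 m k t (Y : F) :
    chord x1 x2 x3 m k -> Y != 0 -> t - x2 != 0 -> t - x3 != 0 ->
    Some (t, m * t + k + Y) \in on_curve E ->
    let U := Some (x2, m * x2 + k) \+e Some (t, m * t + k + Y) in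
    U <> Some (x1, m * x1 + k) -> U <> Some (x1, - (m * x1 + k)) ->
  (Some (x1, m * x1 + k) \+e Some (x2, m * x2 + k)) \+e Some (t, m * t + k + Y)
    = Some (x1, m * x1 + k) \+e U.
Proof.
move=> ch Y0 t2 t3 cT U nU1 nU2; rewrite (chord_add ch).
have cU : U \in on_curve E by rewrite ec_add_curve // (chord_on_curve (chord_rot ch)).
have c1 := chord_on_curve ch.
move: cU nU1 nU2; rewrite /U.
have n2 : (x2 == t) = false by rewrite eq_sym -subr_eq0 (negPf t2).
have n3 : (x3 == t) = false by rewrite eq_sym -subr_eq0 (negPf t3).
rewrite {U} /ec_add n2 n3 /=.
set l1 := (m * t + k + Y - (m * x2 + k)) / (t - x2).
set x4 := l1 ^+ 2 - a2 - x2 - t.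
set y4 := l1 * (x2 - x4) - (m * x2 + k) => cU nU1 nU2.
have n4 : x1 != x4.
  apply: contra_not_neq nU1 => e14; move: cU; rewrite -e14 => cU.
  by case: (on_curve_x c1 cU) => e; [rewrite e | case: nU2; rewrite -e14 e].
rewrite (negPf n4) /=; move: n4; rewrite eq_sym -subr_eq0 => n4.
case: ch cT => e2 e4 e6; rewrite on_curveE e4 e6 e2 => /eqP cT.
have Et : Y ^+ 2 + 2%:R * (m * t + k) * Y = (t - x1) * (t - x2) * (t - x3).
  have -> : Y ^+ 2 + 2%:R * (m * t + k) * Y = (m * t + k + Y) ^+ 2 - (m * t + k) ^+ 2.
    by ring.
  by rewrite cT; ring.
have Ek : k = ((t - x1) * (t - x2) * (t - x3) - Y ^+ 2) / (2%:R * Y) - m * t.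
  by rewrite -Et; field; rewrite Y0 two_neq0.
have El1 : l1 = m + Y / (t - x2) by rewrite /l1; field.
have Ex4 : x4 = l1 ^+ 2 - m ^+ 2 + x1 + x3 - t by rewrite /x4 e2; ring.
rewrite /y4 Ex4 El1; move: n4; rewrite Ex4 El1 Ek => n4.
have n5 : (m * (t - x2) + Y) ^+ 2 + - m ^+ 2 * (t - x2) ^+ 2
    + x1 * (t - x2) ^+ 2 + x3 * (t - x2) ^+ 2 + - t * (t - x2) ^+ 2
    + - x1 * (t - x2) ^+ 2 != 0.
  apply: contra_neq n4 => n5; apply: (mulIf (expf_neq0 2 t2)).
  by rewrite mul0r -n5; field.
by congr (Some (_, _)); field; rewrite n5 t2 t3 two_neq0 Y0.
Qed.

Lemma ec_addA_generic A B : A \in on_curve E -> B \in on_curve E ->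
  exists S : seq (point F), forall T, T \in on_curve E -> T \notin S ->
    (A \+e B) \+e T = A \+e (B \+e T).
Proof.
case: A => [[x1 y1]|] cA; last by exists [::].
case: B => [[x2 y2]|] cB; last by exists [::] => T; rewrite ec_addr0.
set A := Some (x1, y1); set B := Some (x2, y2).
case: (boolP ((x1 == x2) && (y1 + y2 == 0))) => [/andP[/eqP e12 y12]|nAB].
  exists [::] => T cT _.
  have -> : B = ec_opp A.
    by rewrite /A /B e12 /=; congr (Some (_, _)); apply/eqP; rewrite -addr_eq0 addrC.
  have cNA : ec_opp A \in on_curve E by rewrite ec_opp_curve.
  rewrite ec_addN [RHS]ec_addC ?ec_add_curve //.
  by have := ec_addK cNA cT; rewrite ec_oppK => ->.
have [x3 [m [k [ch y1E y2E]]]] := add_chord cA cB nAB.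
exists [:: None; A; ec_opp A; B; ec_opp B; A \+e B; ec_opp (A \+e B);
  A \+e ec_opp B; ec_opp A \+e ec_opp B] => T cT.
rewrite !inE !negb_or; case: T cT => // [[t y]] cT.
case/and5P=> _ nA nNA nB /and5P[nNB nC nNC nD nND].
have nX x' y' : Some (x', y') \in on_curve E -> Some (t, y) != Some (x', y') ->
    Some (t, y) != ec_opp (Some (x', y')) -> t - x' != 0.
  move=> c' n1 n2; rewrite subr_eq0; apply: contraTneq cT => tE.
  apply: contraNN n1; rewrite tE => cT.
  case: (on_curve_x c' cT) => yE; first by rewrite yE.
  by move: n2; rewrite tE yE eqxx.
have t1 := nX _ _ cA nA nNA; have t2 := nX _ _ cB nB nNB.
have eC : A \+e B = Some (x3, - (m * x3 + k)) by rewrite /A /B y1E y2E (chord_add ch).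
have t3 : t - x3 != 0.
  have c3 : A \+e B \in on_curve E by apply: ec_add_curve.
  by rewrite eC in c3; apply: (nX _ _ c3); rewrite -eC.
have yE : y = m * t + k + (y - (m * t + k)) by ring.
have Y0 : y - (m * t + k) != 0.
  case: (ch) cT => e2 e4 e6; rewrite on_curveE e4 e6 e2 => /eqP cT.
  apply: contraNneq (mulf_neq0 t1 (mulf_neq0 t2 t3)) => y0.
  apply/eqP; transitivity (y ^+ 2 - (m * t + k) ^+ 2); first by rewrite cT; ring.
  have -> : y = m * t + k by apply/eqP; rewrite -subr_eq0 y0.
  by rewrite subrr.
rewrite /A /B y1E y2E yE; rewrite yE in cT nD nND; apply: (chord_assoc ch) => //.
- by move=> UE; case/eqP: nD; rewrite -/B -(ec_addK cB cT) /B y2E UE /A y1E.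
- by move=> UE; case/eqP: nND; rewrite -/B -(ec_addK cB cT) /B y2E UE /A y1E.
Qed.

End GroupLaw.

Lemma closed_field_infinite (F : closedFieldType) (s : seq F) :
  exists x, x \notin s.
Proof.
have sz : size (\prod_(a <- s) ('X - a%:P) * 'X + 1 : {poly F}) != 1.
  have n0 : \prod_(a <- s) ('X - a%:P) != 0 :> {poly F}.
    by rewrite -size_poly_eq0 size_prod_XsubC.
  by rewrite size_polyDl size_mulX // size_prod_XsubC // size_poly1.
have [x /rootP rx] := closed_rootP _ sz; exists x.
apply: contraT; rewrite negbK -root_prod_XsubC => /rootP r0.
by move: rx; rewrite !hornerE r0 mul0r add0r => /eqP; rewrite oner_eq0.
Qed.

Section GroupClosed.
Variables (F : closedFieldType) (E : ecurve F).
Hypothesis two_neq0 : 2%:R != 0 :> F.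
Implicit Types (P Q R A B C T : point F).

Local Notation "P \+e Q" := (ec_add E P Q) (at level 50, left associativity).

Lemma on_curve_exists x : exists y, Some (x, y) \in on_curve E.
Proof.
have sz : size ('X^2 - (cubic (ec_a2 E) (ec_a4 E) (ec_a6 E)).[x]%:P : {poly F}) != 1.
  by rewrite size_XnsubC.
have [y /rootP ry] := closed_rootP _ sz; exists y.
by move: ry; rewrite hornerD hornerN hornerXn hornerC => /eqP; rewrite subr_eq0.
Qed.

Lemma on_curve_infinite (S : seq (point F)) :
  exists2 T, T \in on_curve E & T \notin S.
Proof.
have [x xS] := closed_field_infinite [seq (odflt (0, 0) P).1 | P <- S].
have [y c] := on_curve_exists x; exists (Some (x, y)) => //.
by apply: contra xS => /(map_f (fun P => (odflt (0, 0) P).1)).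
Qed.

Lemma ec_addA P Q R : P \in on_curve E -> Q \in on_curve E -> R \in on_curve E ->
  P \+e (Q \+e R) = (P \+e Q) \+e R.
Proof.
move=> cP cQ cR; have cD := ec_add_curve two_neq0.
have cPQ := cD _ _ _ cP cQ; have cQR := cD _ _ _ cQ cR.
have [S1 h1] := ec_addA_generic two_neq0 cPQ cR.
have [S2 h2] := ec_addA_generic two_neq0 cP cQ.
have [S3 h3] := ec_addA_generic two_neq0 cQ cR.
have [S4 h4] := ec_addA_generic two_neq0 cP cQR.
have [T cT] := on_curve_infinite
  (S1 ++ S3 ++ S4 ++ [seq C \+e ec_opp R | C <- S2]).
rewrite !mem_cat !negb_or => /and4P[n1 n3 n4 n2].
have cRT := cD _ _ _ cR cT.
have nRT : R \+e T \notin S2.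
  apply: contra n2 => mRT; apply/mapP; exists (R \+e T) => //.
  by rewrite ec_addK.
have cl := cD _ _ _ cP cQR; have cr := cD _ _ _ cPQ cR.
apply: (ec_addI two_neq0 cT cl cr).
by rewrite ec_addC // [RHS]ec_addC // h1 // h2 // -h3 // -h4.
Qed.

End GroupClosed.

(* The tangent formula of ec_add requires characteristic different from 2. *)
Definition ecp (L : closedFieldType) (E : ecurve L) (two_neq0 : 2%:R != 0 :> L)
  : Type := {P : point L | P \in on_curve E}.

Section EcpGroup.
Variables (L : closedFieldType) (E : ecurve L) (two_neq0 : 2%:R != 0 :> L).
Local Notation G := (@ecp L E two_neq0).

HB.instance Definition _ := SubChoice.copy G {P : point L | P \in on_curve E}.

Definition ecp_add (P Q : G) : G :=
  Sub (ec_add E (val P) (val Q)) (ec_add_curve two_neq0 (valP P) (valP Q)).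
Definition ecp_zero : G := Sub None isT.
Fact ecp_opp_subproof (P : G) : ec_opp (val P) \in on_curve E.
Proof. by rewrite ec_opp_curve (valP P). Qed.
Definition ecp_opp (P : G) : G := Sub (ec_opp (val P)) (ecp_opp_subproof P).

Fact ecp_addA : associative ecp_add.
Proof.
by move=> P Q R; apply: val_inj; rewrite /= (ec_addA two_neq0) // ?(valP P, valP Q, valP R).
Qed.
Fact ecp_addC : commutative ecp_add.
Proof. by move=> P Q; apply: val_inj; rewrite /= ec_addC // ?(valP P, valP Q). Qed.
Fact ecp_add0 : left_id ecp_zero ecp_add.
Proof. by move=> P; apply: val_inj. Qed.
Fact ecp_addN : left_inverse ecp_zero ecp_opp ecp_add.
Proof. by move=> P; rewrite ecp_addC; apply: val_inj; rewrite /= ec_addN. Qed.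

HB.instance Definition _ :=
  GRing.isZmodule.Build G ecp_addA ecp_addC ecp_add0 ecp_addN.

Lemma val_ecpD (P Q : G) : val (P + Q) = ec_add E (val P) (val Q).
Proof. by []. Qed.

Lemma val_ecpN (P : G) : val (- P) = ec_opp (val P).
Proof. by []. Qed.

Lemma val_ecp0 : val (0 : G) = None.
Proof. by []. Qed.

Definition xcoord (P : G) : P1 L := omap fst (val P).

Lemma xcoord_surj (u : P1 L) : exists P, xcoord P = u.
Proof.
case: u => [x|]; last by exists 0.
by have [y c] := on_curve_exists E x; exists (Sub (Some (x, y)) c).
Qed.

Lemma xcoord_eq (P Q : G) : xcoord P = xcoord Q <-> P = Q \/ P = - Q.
Proof.
split=> [|[-> //|->]]; last by rewrite /xcoord val_ecpN; case: (val Q) => [[]|].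
rewrite /xcoord; case: P Q => [[[x y]|] cP] [[[x' y']|] cQ] //=; last first.
  by left; apply: val_inj.
case=> e; subst x'; case: (on_curve_x cQ cP) => e; [left | right];
  by apply: val_inj; rewrite /= e.
Qed.

Definition ecp_lift (phi : point L -> point L) (P : G) : G := insubd (0 : G) (phi (val P)).

Lemma val_ecp_lift phi P : {homo phi : Q / Q \in on_curve E} ->
  val (ecp_lift phi P) = phi (val P).
Proof. by move=> homo_phi; rewrite val_insubd homo_phi ?(valP P). Qed.

Lemma ecp_liftD phi : endomorphism E phi -> {morph ecp_lift phi : P Q / P + Q}.
Proof.
case=> homo_phi morph_phi _ P Q; apply: val_inj.
by rewrite !(val_ecp_lift _ homo_phi, val_ecpD) morph_phi // ?(valP P, valP Q).
Qed.

End EcpGroup.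

Section Morphism.
Variables (U V : zmodType) (f : U -> V).
Hypothesis fD : {morph f : x y / x + y}.

Lemma morph0 : f 0 = 0.
Proof. by apply: (addrI (f 0)); rewrite -fD !addr0. Qed.

Lemma morphN x : f (- x) = - f x.
Proof. by apply/eqP; rewrite -addr_eq0 -fD addNr morph0. Qed.

Lemma morphB x y : f (x - y) = f x - f y.
Proof. by rewrite fD morphN. Qed.

Lemma morphMn n x : f (x *+ n) = f x *+ n.
Proof. by elim: n => [|n ih]; rewrite ?morph0 // !mulrS fD ih. Qed.

End Morphism.

Lemma iter_morphD (U : zmodType) (f : U -> U) n :
  {morph f : x y / x + y} -> {morph iter n f : x y / x + y}.
Proof. by move=> fD; elim: n => [|n ih] x y //=; rewrite ih fD. Qed.

(** * Regular functions on the affine curve *)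

Section CofinitePolynomials.
Variable L : closedFieldType.
Implicit Types (p q : {poly L}) (s : seq L).

Lemma poly_roots p : p != 0 -> exists s, forall x, p.[x] = 0 -> x \in s.
Proof.
move=> p0; have [s pE] := closed_field_poly_normal p; exists s => x /rootP.
by rewrite pE rootZ ?lead_coef_eq0 // root_prod_XsubC.
Qed.

Lemma poly_eq0_cofinite p s : (forall x, x \notin s -> p.[x] = 0) -> p = 0.
Proof.
move=> h; apply/eqP; apply/negPn/negP => /poly_roots[s' hs'].
have [x] := closed_field_infinite (s ++ s').
by rewrite mem_cat negb_or => /andP[/h/hs' ->].
Qed.

End CofinitePolynomials.

Section RegularFunctions.
Variables (L : closedFieldType) (E : ecurve L).
Hypothesis two_neq0 : 2%:R != 0 :> L.
Implicit Types (g h : L -> L -> L) (p : {poly L}).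

Local Notation f := (cubic (ec_a2 E) (ec_a4 E) (ec_a6 E)).

Lemma cubic_neq0 : f != 0.
Proof.
apply: contraTneq (ec_smooth E) => ->.
by rewrite separable_poly.unlock deriv0 coprimep0 -size_poly_eq1 size_poly0.
Qed.

Lemma on_curve_cubic x y : Some (x, y) \in on_curve E -> y ^+ 2 = f.[x].
Proof. by rewrite inE => /eqP. Qed.

Definition regular g : Prop := exists a b : {poly L},
  forall x y, Some (x, y) \in on_curve E -> g x y = a.[x] + b.[x] * y.

Lemma regular_poly p : regular (fun x _ => p.[x]).
Proof. by exists p, 0 => x y _; rewrite horner0 mul0r addr0. Qed.

Lemma regular_y : regular (fun _ y => y).
Proof. by exists 0, 1 => x y _; rewrite !hornerE. Qed.

Lemma regularD g h : regular g -> regular h -> regular (fun x y => g x y + h x y).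
Proof.
move=> [a [b gE]] [c [d hE]]; exists (a + c), (b + d) => x y cxy.
by rewrite gE // hE // !hornerD; ring.
Qed.

Lemma regularM g h : regular g -> regular h -> regular (fun x y => g x y * h x y).
Proof.
move=> [a [b gE]] [c [d hE]]; exists (a * c + b * d * f), (a * d + b * c).
move=> x y cxy; rewrite gE // hE //.
have := on_curve_cubic cxy; move: f => F fE.
by rewrite !(hornerD, hornerM) -fE; ring.
Qed.

Lemma regularN g : regular g -> regular (fun x y => - g x y).
Proof.
move=> [a [b gE]]; exists (- a), (- b) => x y cxy.
by rewrite gE // !hornerN; ring.
Qed.

Lemma regularX g n : regular g -> regular (fun x y => g x y ^+ n).
Proof.
move=> gr; elim: n => [|n ih].
  by exists 1, 0 => x y _; rewrite !hornerE.
have [a [b hE]] := regularM gr ih; exists a, b => x y cxy.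
by rewrite exprS hE.
Qed.

Lemma regular_sum n (g : nat -> L -> L -> L) :
  (forall i, regular (g i)) -> regular (fun x y => \sum_(i < n) g i x y).
Proof.
move=> gr; elim: n => [|n ih].
  by exists 0, 0 => x y _; rewrite big_ord0 !hornerE.
have [a [b hE]] := regularD ih (gr n); exists a, b => x y cxy.
by rewrite big_ord_recr /= hE.
Qed.

Lemma regular_poly2 (B : {poly {poly L}}) : regular (fun x y => B.[x%:P].[y]).
Proof.
have [a [b hE]] : regular (fun x y =>
    \sum_(i < size B) (\sum_(j < size B`_i) ((B`_i)`_j)%:P.[x] * y ^+ j) * 'X.[x] ^+ i).
  apply: (@regular_sum _ (fun i x y =>
    (\sum_(j < size B`_i) ((B`_i)`_j)%:P.[x] * y ^+ j) * 'X.[x] ^+ i)) => i.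
  apply: regularM; last by apply: regularX; apply: regular_poly.
  apply: (@regular_sum _ (fun j x y => ((B`_i)`_j)%:P.[x] * y ^+ j)) => j.
  by apply: regularM; [apply: regular_poly | apply: regularX; apply: regular_y].
exists a, b => x y cxy; rewrite -hE // (horner_coef B) horner_sum.
apply: eq_bigr => i _; rewrite -polyC_exp hornerM hornerC hornerX; congr (_ * _).
by rewrite horner_coef; apply: eq_bigr => j _; rewrite hornerC.
Qed.

Lemma regular_eq0 g (s : seq L) : regular g ->
  (forall x y, Some (x, y) \in on_curve E -> x \notin s -> g x y = 0) ->
  forall x y, Some (x, y) \in on_curve E -> g x y = 0.
Proof.
move=> [a [b gE]] g0.
have [t ft] := poly_roots cubic_neq0.
have ab0 x : x \notin s ++ t -> a.[x] = 0 /\ b.[x] = 0.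
  rewrite mem_cat negb_or => /andP[xs xt]; have [y cy] := on_curve_exists E x.
  have cNy : Some (x, - y) \in on_curve E by rewrite -(ec_opp_curve E) /= opprK.
  have e1 := g0 _ _ cy xs; have e2 := g0 _ _ cNy xs.
  rewrite (gE _ _ cy) in e1; rewrite (gE _ _ cNy) in e2.
  have y0 : y != 0.
    apply: contraNneq xt => y0; apply: ft.
    by rewrite -(on_curve_cubic cy) y0 expr0n.
  have a0 : a.[x] = 0.
    apply: (mulfI two_neq0); rewrite mulr0 -[RHS](addr0 0) -{1}e1 -e2; ring.
  split=> //; apply: (mulIf y0); by rewrite mul0r -[RHS]e1 a0 add0r.
have a0 : a = 0 by apply: (@poly_eq0_cofinite _ _ (s ++ t)) => x /ab0[].
have b0 : b = 0 by apply: (@poly_eq0_cofinite _ _ (s ++ t)) => x /ab0[].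
by move=> x y cxy; rewrite gE // a0 b0 !hornerE.
Qed.

End RegularFunctions.

(** * Endomorphisms in standard form *)

Section StandardForm.
Variables (L : closedFieldType) (E : ecurve L).
Hypothesis two_neq0 : 2%:R != 0 :> L.
Variables (alpha : point L -> point L) (r s : ratfun L).
Hypothesis alpha_end : endomorphism E alpha.
Hypothesis alpha_rs : standard_form E alpha r s.

Local Notation f := (cubic (ec_a2 E) (ec_a4 E) (ec_a6 E)).
Local Notation N := (rnum r).
Local Notation M := (rden r).
Local Notation G := (@ecp L E two_neq0).

Let homo_alpha : {homo alpha : P / P \in on_curve E}.
Proof. by case: alpha_end. Qed.

Lemma coprimep_num_root (t : ratfun L) x : (rden t).[x] = 0 -> (rnum t).[x] != 0.
Proof.
by move=> d0; have := rnum_rden_coprime t; rewrite coprimep_sym => /coprimep_root->; rewrite // rootE d0.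
Qed.

Lemma standard_form_curve x : M.[x] != 0 -> (rden s).[x] != 0 ->
  f.[x] * ((rnum s).[x] / (rden s).[x]) ^+ 2 = f.[N.[x] / M.[x]].
Proof.
move=> Mx sx; have [y cy] := on_curve_exists E x.
have := homo_alpha cy; rewrite (alpha_rs cy) /= (negPf Mx) (negPf sx) => c'.
by rewrite -(on_curve_cubic cy) -(on_curve_cubic c') [RHS]exprMn.
Qed.

(* If s has a pole at x and r has not, the identity f s^2 = f(r), cleared of
   denominators, shows that x is a double root of f. *)
Lemma standard_form_pole x : M.[x] != 0 -> (rden s).[x] != 0.
Proof.
move=> Mx; apply/negP => /eqP sx.
pose H := N ^+ 3 + ec_a2 E *: (N ^+ 2 * M) + ec_a4 E *: (N * M ^+ 2)
          + ec_a6 E *: M ^+ 3.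
have [m Mm] := poly_roots (rden_neq0 r).
have [t st] := poly_roots (rden_neq0 s).
have idE : f * rnum s ^+ 2 * M ^+ 3 = rden s ^+ 2 * H.
  apply/eqP; rewrite -subr_eq0; apply/eqP.
  apply: (@poly_eq0_cofinite _ _ (m ++ t)) => z.
  rewrite mem_cat negb_or => /andP[zm zt].
  have Mz : M.[z] != 0 by apply: contraNneq zm => /Mm.
  have sz : (rden s).[z] != 0 by apply: contraNneq zt => /st.
  have := standard_form_curve Mz sz; rewrite (horner_cubic _ _ _ (_ / _)).
  move: (f) => F.
  set FN := _ + _ + _ + _ => FNE; rewrite /H.
  rewrite !(hornerD, hornerN, hornerM, horner_exp, hornerZ).
  transitivity ((rden s).[z] ^+ 2 * M.[z] ^+ 3 *
                (F.[z] * ((rnum s).[z] / (rden s).[z]) ^+ 2 - FN)).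
    by rewrite /FN; field; rewrite Mz sz.
  by rewrite FNE subrr mulr0.
have f0 : f.[x] = 0.
  have := congr1 (horner^~ x) idE; rewrite /= !(horner_exp, hornerM) sx.
  rewrite expr0n mul0r => /eqP; rewrite !(expf_eq0, mulf_eq0) /= (negPf Mx).
  by rewrite (negPf (coprimep_num_root sx)) !orbF => /eqP.
have := congr1 (fun p => p^`().[x]) idE.
move: f0; have := horner_deriv_cubic (ec_a2 E) (ec_a4 E) (ec_a6 E) x.
have := @cubic_simple_root _ E x; rewrite -horner_cubic.
move: (f) H {idE} => F H simple dF F0; have := simple F0; rewrite -dF => F'0.
rewrite !(deriv_exp, derivM) !(hornerD, hornerM, horner_exp, hornerMn) F0 sx.
rewrite !(mulr0, mul0r, mul0rn, expr0n, addr0, add0r).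
move/eqP; rewrite !(expf_eq0, mulf_eq0) /= (negPf Mx) (negPf F'0).
by rewrite (negPf (coprimep_num_root sx)).
Qed.

Lemma standard_formE x y : Some (x, y) \in on_curve E ->
  alpha (Some (x, y)) = if M.[x] == 0 then None
    else Some (N.[x] / M.[x], y * ((rnum s).[x] / (rden s).[x])).
Proof.
move=> cxy; rewrite alpha_rs //=.
by case: eqP => [//|/eqP/standard_form_pole/negPf->].
Qed.

Local Notation a := (@ecp_lift L E two_neq0 alpha).

Let aD : {morph a : P Q / P + Q} := ecp_liftD alpha_end.

Lemma horner_homog (p : {poly L}) n (g w : L) : (size p <= n.+1)%N -> w != 0 ->
  \sum_(i < n.+1) p`_i * g ^+ i * w ^+ (n - i) = w ^+ n * p.[g / w].
Proof.
move=> szp w0; rewrite (horner_coef_wide _ szp) mulr_sumr.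
apply: eq_bigr => -[i /=]; rewrite ltnS => le_in _.
rewrite -{2}(subnK le_in) exprD expr_div_n; field.
by rewrite expf_neq0.
Qed.

Lemma horner_homog0 (p : {poly L}) n (g : L) :
  \sum_(i < n.+1) p`_i * g ^+ i * 0 ^+ (n - i) = p`_n * g ^+ n.
Proof.
rewrite big_ord_recr /= subnn expr0 mulr1 big1 ?add0r // => -[i lt_in] _ /=.
by rewrite expr0n subn_eq0 leqNgt lt_in mulr0.
Qed.

Lemma kernel_ordinate x0 y0 : Some (x0, y0) \in on_curve E ->
  alpha (Some (x0, y0)) = None -> M.[x0] = 0.
Proof. by move=> c0; rewrite standard_formE //; case: eqP. Qed.

(* Near P = - P0 the abscissa g = u / w of P0 + P has a pole; as
   r(g) = r(x), so has r at infinity. *)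
Lemma ratfun_inf_aux x0 y0 (u w : L -> L -> L) :
    Some (x0, y0) \in on_curve E -> alpha (Some (x0, y0)) = None ->
    regular E u -> regular E w ->
    (forall x y, Some (x, y) \in on_curve E -> x != x0 -> w x y != 0 /\
      ((y - y0) / (x - x0)) ^+ 2 - ec_a2 E - x0 - x = u x y / w x y) ->
    w x0 (- y0) = 0 -> u x0 (- y0) != 0 ->
  (size M < size N)%N.
Proof.
move=> c0 a0 ru rw uw w0 u0; rewrite ltnNge; apply/negP => szNM.
have Mx0 := kernel_ordinate c0 a0.
pose n := (size M).-1.
have szM : size M = n.+1 by rewrite prednK // lt0n size_poly_eq0 rden_neq0.
pose h (p : {poly L}) x y := \sum_(i < n.+1) p`_i * u x y ^+ i * w x y ^+ (n - i).
have rh p : regular E (h p).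
  apply: (@regular_sum _ E n.+1 (fun i x y => p`_i * u x y ^+ i * w x y ^+ (n - i))).
  move=> i; apply: regularM; last exact: regularX.
  apply: regularM; last exact: regularX.
  have [b [c e]] := regular_poly E (p`_i)%:P; exists b, c => x y cxy.
  by rewrite -e // hornerC.
have key x y : Some (x, y) \in on_curve E -> x != x0 ->
    h N x y * M.[x] = N.[x] * h M x y.
  move=> cxy nx; have [wxy gE] := uw _ _ cxy nx.
  rewrite /h !horner_homog ?szM // -?gE; last by rewrite -szM.
  set g := _ ^+ 2 - _ - _ - _ in gE *.
  suff e : N.[g] * M.[x] = N.[x] * M.[g] by rewrite -mulrA e; ring.
  have cD := ec_add_curve two_neq0 c0 cxy.
  have [_ morph_alpha _] := alpha_end.
  have := morph_alpha _ _ c0 cxy; rewrite a0.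
  move: cD; rewrite /ec_add eq_sym (negPf nx) /= -/g => cD.
  rewrite !standard_formE //.
  have [Mg|Mg] := eqVneq M.[g] 0; have [Mx|Mx] := eqVneq M.[x] 0 => //=.
    by rewrite Mg Mx !mulr0.
  case=> e _.
  apply: (mulIf (invr_neq0 Mg)); apply: (mulIf (invr_neq0 Mx)).
  transitivity (N.[g] / M.[g]); first by field; rewrite Mg Mx.
  by rewrite e; field; rewrite Mg Mx.
have cN0 : Some (x0, - y0) \in on_curve E by rewrite -(ec_opp_curve E) /= opprK.
have reg : regular E (fun x y => h N x y * M.[x] + - (N.[x] * h M x y)).
  apply: regularD; first by apply: regularM => //; apply: regular_poly.
  by apply: regularN; apply: regularM => //; apply: regular_poly.
have := @regular_eq0 _ E two_neq0 _ [:: x0] reg _ _ _ cN0.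
rewrite /h w0 !horner_homog0 Mx0 mulr0 add0r => /(_ _)/eqP.
rewrite oppr_eq0 !mulf_eq0 expf_eq0 (negPf u0) andbF orbF.
rewrite (negPf (coprimep_num_root Mx0)) /= -[M`_n]/(lead_coef M) lead_coef_eq0.
rewrite (negPf (rden_neq0 r)) => /(_ _)/notF; apply => x y cxy.
by rewrite inE => nx; rewrite key // subrr.
Qed.

Lemma ratfun_inf (P0 : G) : P0 != 0 -> a P0 = 0 -> (size M < size N)%N.
Proof.
case: P0 => [[[x0 y0]|] c0]; last by move=> /eqP[]; apply: val_inj.
move=> _ /(congr1 val); rewrite val_ecp_lift //= => a0.
pose e2 := ec_a2 E; pose e4 := ec_a4 E.
have rX : regular E (fun x _ => x).
  by have [b [c e]] := regular_poly E 'X; exists b, c => x y /e <-; rewrite hornerX.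
have rC c : regular E (fun _ _ => c).
  by have [b [d e]] := regular_poly E c%:P; exists b, d => x y /e <-; rewrite hornerC.
have [y00|y00] := eqVneq y0 0; last first.
  apply: (ratfun_inf_aux (u := fun x y => (y + - y0) ^+ 2 +
      - ((e2 + x0 + x) * (x + - x0) ^+ 2)) (w := fun x y => (x + - x0) ^+ 2) c0 a0).
  - apply: regularD; first by apply/regularX/regularD/rC/regular_y.
    apply: regularN; apply: regularM; last by apply/regularX/regularD/rC.
    by apply: regularD.
  - by apply/regularX/regularD/rC.
  - move=> x y _; rewrite -subr_eq0 => nx; rewrite expf_neq0 //; split=> //.
    by rewrite -/e2; field.
  - by rewrite subrr expr0n.
  rewrite subrr expr0n mulr0 oppr0 addr0 expf_neq0 //.
  have -> : - y0 - y0 = - (2%:R * y0) by ring.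
  by rewrite oppr_eq0 mulf_neq0.
subst y0; have := c0; rewrite on_curveE expr2 mulr0 eq_sym => /eqP f0.
apply: (ratfun_inf_aux (u := fun x y => x ^+ 2 + x * x0 + x0 ^+ 2 + e2 * (x + x0) + e4 +
      - ((e2 + x0 + x) * (x + - x0))) (w := fun x y => (x + - x0)) c0 a0).
- apply: regularD.
    apply: regularD => //; apply: regularD; last first.
      by apply: regularM => //; apply: regularD.
    apply: regularD => //; apply: regularD; first exact: regularX.
    exact: regularM.
  by apply: regularN; apply: regularM; apply: regularD => //; apply: regularD.
- exact: regularD.
- move=> x y; rewrite on_curveE => /eqP cxy; rewrite -subr_eq0 => nx; split=> //.
  rewrite subr0 expr_div_n cxy; move: f0; rewrite -/e2 -/e4 => f0.
  have -> : x ^+ 3 + e2 * x ^+ 2 + e4 * x + ec_a6 E = (x - x0) *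
      (x ^+ 2 + x * x0 + x0 ^+ 2 + e2 * (x + x0) + e4).
    by rewrite -[RHS]addr0 -f0; ring.
  by field.
- by rewrite subrr.
rewrite subrr mulr0 oppr0 addr0; have := cubic_simple_root f0.
by rewrite -/e2 -/e4; congr (_ != 0); ring.
Qed.

End StandardForm.

(** * Fibres and the kernel of alpha *)

Lemma coprimep_closed (L : closedFieldType) (p q : {poly L}) :
  (forall x, p.[x] = 0 -> q.[x] != 0) -> coprimep p q.
Proof.
move=> pq; rewrite coprimep_def; apply/negPn/negP => /closed_rootP[x].
by rewrite root_gcd => /andP[/rootP/pq/negP].
Qed.

Section Wronskian.
Variables (L : fieldType) (p l : nat) (N M : {poly L}).
Hypothesis p_char : p \in [pchar L].
Hypothesis l_prime : prime l.
Hypothesis NM : coprimep N M.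
Hypothesis szN : size N = l.+1.
Hypothesis szM : (size M <= l)%N.

Lemma wronskian_neq0 : (1 < size M)%N -> N^`() * M - N * M^`() != 0.
Proof.
move=> szM1; apply/negP; rewrite subr_eq0 => /eqP W0.
have dM : M %| M^`().
  by rewrite -(Gauss_dvdpr _ (q := N)) 1?coprimep_sym // -W0 dvdp_mulIr.
have M0 : M != 0 by rewrite -size_poly_gt0 ltnW.
have M'0 : M^`() = 0.
  apply/eqP/negPn/negP => /dvdp_leq/(_ dM).
  by rewrite leqNgt lt_size_deriv.
have N'0 : N^`() = 0.
  by apply/eqP; move/eqP: W0; rewrite M'0 mulr0 mulf_eq0 (negPf M0) orbF.
have lp : l = p.
  have := congr1 (fun P : {poly L} => P`_l.-1) N'0; rewrite coef_deriv coef0.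
  rewrite prednK ?prime_gt0 // -mulr_natr => /eqP; rewrite mulf_eq0.
  rewrite -[l in N`_l]/(l.+1.-1) -szN -/(lead_coef N) lead_coef_eq0.
  rewrite -size_poly_eq0 szN /= -(dvdn_pcharf p_char) dvdn_prime2 ?(pcharf_prime p_char) //.
  by move/eqP.
move: szM1; rewrite ltnNge => /negP; apply.
apply/leq_sizeP => j j0; have [jl|lj] := ltnP j l; last first.
  by move/leq_sizeP: szM; apply.
have := congr1 (fun P : {poly L} => P`_j.-1) M'0; rewrite coef_deriv coef0.
rewrite prednK // -mulr_natr => /eqP; rewrite mulf_eq0 => /orP[/eqP//|].
rewrite -(dvdn_pcharf p_char) -lp => /(dvdn_leq j0).
by rewrite leqNgt jl.
Qed.

End Wronskian.

Section PrimeKernel.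
Variables (U : zmodType) (h : U -> U) (K : seq U) (l : nat).
Hypothesis hD : {morph h : x y / x + y}.
Hypothesis l_prime : prime l.
Hypothesis uniqK : uniq K.
Hypothesis sizeK : size K = l.
Hypothesis memK : forall x, (h x == 0) = (x \in K).

(* Translation by x permutes K, so l x = 0 by summing over K. *)
Lemma prime_kernel_mulrn x : h x = 0 -> x *+ l = 0.
Proof.
move=> hx.
have uniqK' : uniq [seq y + x | y <- K] by rewrite map_inj_uniq //; apply: addIr.
have subK : {subset [seq y + x | y <- K] <= K}.
  by move=> _ /mapP[y + ->]; rewrite -!memK hD hx addr0.
have [|_ eqK] := uniq_min_size uniqK' subK; first by rewrite size_map.
have := perm_big _ (uniq_perm uniqK' uniqK eqK)
  (op := +%R) (x := 0) (P := xpredT) (F := id).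
rewrite big_map big_split /= big_const_seq count_predT sizeK iter_addr_0.
by rewrite -[RHS]addr0 => /addrI.
Qed.

Lemma prime_kernel_cyclic x y : x != 0 -> h x = 0 -> h y = 0 ->
  exists i, y = x *+ i.
Proof.
move=> nx hx hy; have lx := prime_kernel_mulrn hx.
have inj i j : (i < j < l)%N -> x *+ i <> x *+ j.
  move=> /andP[ij jl] e.
  have kx : x *+ (j - i) = 0 by rewrite mulrnBr ?(ltnW ij) // e subrr.
  have co : coprime (j - i) l.
    rewrite coprime_sym prime_coprime // gtnNdvd ?subn_gt0 //.
    exact: leq_ltn_trans (leq_subr i j) jl.
  have ji0 : (0 < j - i)%N by rewrite subn_gt0.
  case: (egcdnP l ji0) => km kn e2 _.
  have : x *+ (km * (j - i)) = x *+ (kn * l) + x.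
    by rewrite e2 (eqP co) mulrnDr mulr1n.
  rewrite [(km * _)%N]mulnC [(kn * _)%N]mulnC !mulrnA kx lx !mul0rn add0r => x0.
  by rewrite -x0 eqxx in nx.
pose K' := [seq x *+ i | i <- iota 0 l].
have uniqK' : uniq K'.
  rewrite map_inj_in_uniq ?iota_uniq // => i j; rewrite !mem_iota /= !add0n => il jl e.
  have [ij|ji|//] := ltngtP i j.
    by case: (@inj i j); rewrite ?ij.
  by case: (@inj j i); rewrite ?ji.
have subK : {subset K' <= K}.
  by move=> _ /mapP[i _ ->]; rewrite -memK (morphMn hD) hx mul0rn.
have [|_ eK] := uniq_min_size uniqK' subK; first by rewrite sizeK size_map size_iota.
have /mapP[i _ ->] : y \in K' by rewrite eK -memK hy.
by exists i.
Qed.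

End PrimeKernel.

Section Fibres.
Variables (L : closedFieldType) (E : ecurve L).
Hypothesis two_neq0 : 2%:R != 0 :> L.
Variables (p l : nat).
Hypothesis p_char : p \in [pchar L].
Hypothesis l_prime : prime l.
Variables (alpha : point L -> point L) (r s : ratfun L).
Hypothesis alpha_end : endomorphism E alpha.
Hypothesis alpha_rs : standard_form E alpha r s.
Hypothesis alpha_deg : ratfun_degree r = l.

Local Notation f := (cubic (ec_a2 E) (ec_a4 E) (ec_a6 E)).
Local Notation N := (rnum r).
Local Notation M := (rden r).
Local Notation G := (@ecp L E two_neq0).
Local Notation a := (@ecp_lift L E two_neq0 alpha).

Hypothesis ker_neq0 : exists2 P0 : G, P0 != 0 & a P0 = 0.

Let aD : {morph a : P Q / P + Q} := ecp_liftD alpha_end.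
Let homo_alpha : {homo alpha : P / P \in on_curve E}.
Proof. by case: alpha_end. Qed.

Lemma size_den_lt_num : (size M < size N)%N.
Proof. by have [P0 nP0 aP0] := ker_neq0; apply: ratfun_inf alpha_end alpha_rs P0 nP0 aP0. Qed.

Lemma size_num : size N = l.+1.
Proof.
move: size_den_lt_num alpha_deg; rewrite /ratfun_degree.
case: (size N) => // i; rewrite ltnS => lt <- /=.
by rewrite (maxn_idPl _) // (leq_trans (leq_pred _) lt).
Qed.

Lemma size_den : (size M <= l)%N.
Proof. by rewrite -ltnS -size_num size_den_lt_num. Qed.

Lemma size_den_gt1 : (1 < size M)%N.
Proof.
have [[[[x0 y0]|] c0] nP0 aP0] := ker_neq0; last by case/eqP: nP0; apply: val_inj.
move/(congr1 val): aP0; rewrite val_ecp_lift //= => a0.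
have := kernel_ordinate alpha_end alpha_rs c0 a0; rewrite ltnNge => Mx0.
apply/negP => /size1_polyC MC; have := rden_neq0 r.
by move: Mx0; rewrite MC hornerC => ->; rewrite eqxx.
Qed.

Lemma xcoord_alpha P : ratfun_eval r (xcoord P) = xcoord (a P).
Proof.
rewrite /xcoord val_ecp_lift //; case: P => [[[x y]|] c] /=.
  by rewrite (standard_formE alpha_end alpha_rs) //; case: ifP.
have := congr1 val (morph0 aD); rewrite val_ecp_lift // size_den_lt_num.
by rewrite val_ecp0 => ->.
Qed.

Lemma alpha_surj (Q : G) : exists P, a P = Q.
Proof.
case: Q => [[[u v]|] cQ]; last first.
  by exists 0; rewrite (morph0 aD); apply: val_inj.
have sz : size (N - u *: M) != 1%N.
  rewrite size_polyDl ?size_num; first by rewrite eqSS -lt0n prime_gt0.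
  by rewrite size_polyN (leq_ltn_trans (size_scale_leq _ _)) // ltnS size_den.
have [x /rootP] := closed_rootP _ sz; rewrite hornerD hornerN hornerZ => /eqP.
rewrite subr_eq0 => /eqP Nx.
have Mx : M.[x] != 0.
  by apply/negP => /eqP Mx; have := coprimep_num_root Mx; rewrite Nx Mx mulr0 eqxx.
have [P Px] := @xcoord_surj L E two_neq0 (Some x).
have : xcoord (a P) = xcoord (Sub (Some (u, v)) cQ : G).
  by rewrite -xcoord_alpha Px /= (negPf Mx) Nx mulfK.
move/xcoord_eq => [aP|aP]; first by exists P.
by exists (- P); rewrite (morphN aD) aP opprK.
Qed.

Definition fibre_root u v x : Prop :=
  [/\ M.[x] != 0, N.[x] = u * M.[x], (rnum s).[x] != 0, (rden s).[x] != 0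
    & let y := v / ((rnum s).[x] / (rden s).[x]) in
      Some (x, y) \in on_curve E /\ alpha (Some (x, y)) = Some (u, v)].

Lemma generic_fibre : exists S : seq L, forall u v,
  Some (u, v) \in on_curve E -> u \notin S ->
  exists rs : seq L, [/\ uniq rs, size rs = l,
    forall x, x \in rs -> fibre_root u v x
    & forall x, M.[x] != 0 -> N.[x] = u * M.[x] -> x \in rs].
Proof.
have NM : coprimep N M := rnum_rden_coprime r.
have W0 := wronskian_neq0 p_char l_prime NM size_num size_den size_den_gt1.
have [t Wt] := poly_roots W0; have [t' ft'] := poly_roots (cubic_neq0 E).
exists (t' ++ [seq N.[x] / M.[x] | x <- t]) => u v cuv.
rewrite mem_cat negb_or => /andP[ut' ut].
have lF : lead_coef (N - u *: M) = lead_coef N.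
  rewrite lead_coefDl // size_polyN (leq_ltn_trans (size_scale_leq _ _)) //.
  by rewrite size_den_lt_num.
have szF : size (N - u *: M) = l.+1.
  rewrite size_polyDl ?size_num // size_polyN (leq_ltn_trans (size_scale_leq _ _)) //.
  by rewrite ltnS size_den.
have FE x : (N - u *: M).[x] = N.[x] - u * M.[x] by rewrite !hornerE.
have Fx x : (N - u *: M).[x] = 0 -> M.[x] != 0 /\ N.[x] = u * M.[x].
  rewrite FE => /eqP; rewrite subr_eq0 => /eqP Nx; split=> //.
  by apply/negP => /eqP Mx; have := coprimep_num_root Mx; rewrite Nx Mx mulr0 eqxx.
have sepF : separable_poly (N - u *: M).
  rewrite separable_poly.unlock; apply: coprimep_closed => x /Fx[Mx Nx].
  apply: contraNneq ut; rewrite derivB derivZ hornerD hornerN hornerZ.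
  move/eqP; rewrite subr_eq0 => /eqP N'x; apply/mapP; exists x.
    by apply: Wt; rewrite !hornerE Nx N'x; ring.
  by rewrite Nx mulfK.
have F0 : N - u *: M != 0 by rewrite -size_poly_gt0 szF.
have [rs Frs] := closed_field_poly_normal (N - u *: M).
have l0 : lead_coef (N - u *: M) != 0 by rewrite lead_coef_eq0.
have mem_rs x : (x \in rs) = ((N - u *: M).[x] == 0).
  by rewrite -root_prod_XsubC -(rootZ _ _ l0) -Frs.
have v0 : v != 0.
  apply: contraNneq ut' => v0; apply: ft'.
  by rewrite -(on_curve_cubic cuv) v0 expr0n.
exists rs; split.
- rewrite -separable_prod_XsubC -(eqp_separable (eqp_scale _ l0)).
  by rewrite -Frs.
- move: szF; rewrite {1}Frs size_scale // size_prod_XsubC.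
  by case.
- move=> x; rewrite mem_rs => /eqP/Fx[Mx Nx].
  have sx := standard_form_pole alpha_end alpha_rs Mx.
  have := standard_form_curve alpha_end alpha_rs Mx sx.
  have -> : N.[x] / M.[x] = u by rewrite Nx mulfK.
  rewrite -(on_curve_cubic cuv) => fs.
  have nsx : (rnum s).[x] != 0.
    apply: contraNneq v0 => sx0; move/eqP: fs.
    by rewrite sx0 mul0r expr0n mulr0 eq_sym expf_eq0.
  split=> // y; have sxn0 : (rnum s).[x] / (rden s).[x] != 0.
    by rewrite mulf_neq0 ?invr_eq0.
  have cxy : Some (x, y) \in on_curve E.
    rewrite inE /y expr_div_n -fs; apply/eqP.
    by rewrite mulfK // expf_neq0.
  split=> //; rewrite (standard_formE alpha_end alpha_rs) // (negPf Mx).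
  by rewrite Nx mulfK // /y mulfVK.
by move=> x Mx Nx; rewrite mem_rs FE Nx subrr.
Qed.

Lemma kernel_enum : exists K : seq G,
  [/\ uniq K, size K = l & forall P, (a P == 0) = (P \in K)].
Proof.
have [S fib] := generic_fibre.
have [u uS] := closed_field_infinite S.
have [v cuv] := on_curve_exists E u.
have [rs [urs szrs rsP rs_max]] := fib u v cuv uS.
pose sx x := (rnum s).[x] / (rden s).[x].
pose mk x : G := insubd (0 : G) (Some (x, v / sx x)).
have mkE x : x \in rs -> val (mk x) = Some (x, v / sx x).
  by move=> /rsP[_ _ _ _ [cx _]]; rewrite val_insubd cx.
pose Q : G := Sub (Some (u, v)) cuv.
have amk x : x \in rs -> a (mk x) = Q.
  move=> xrs; apply: val_inj; rewrite val_ecp_lift // mkE //.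
  by have [_ _ _ _ [_ ->]] := rsP _ xrs.
have mk_max P : a P = Q -> P \in map mk rs.
  move=> /(congr1 val); rewrite val_ecp_lift //=.
  case: P => [[[x y]|] cP] /=; last first.
    by have := congr1 val (morph0 aD); rewrite val_ecp_lift // !val_ecp0 => ->.
  rewrite (standard_formE alpha_end alpha_rs) //; case: eqP => // /eqP Mx [Nx yx].
  have xrs : x \in rs by apply: rs_max => //; rewrite -Nx mulfVK.
  apply/mapP; exists x => //; apply: val_inj; rewrite mkE //=; congr (Some (_, _)).
  have [_ _ n0 d0 _] := rsP _ xrs.
  by rewrite -yx -/(sx x) mulfK // mulf_neq0 ?invr_eq0.
have [x1 x1rs] : exists x1, x1 \in rs.
  case: (rs) szrs => [l0|x1 rs' _]; last by exists x1; rewrite mem_head.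
  by have := prime_gt0 l_prime; rewrite -l0.
exists [seq mk x - mk x1 | x <- rs]; split; last 2 first.
- by rewrite size_map.
- move=> P; apply/eqP/mapP => [aP|[x xrs ->]]; last first.
    by rewrite (morphB aD) !amk ?subrr.
  have /mk_max/mapP[x xrs e] : a (P + mk x1) = Q by rewrite aD aP add0r amk.
  by exists x => //; rewrite -e addrK.
rewrite map_inj_in_uniq // => x x' xrs x'rs /addIr /(congr1 val).
by rewrite !mkE // => -[].
Qed.

Lemma kernel_cyclic (P0 P : G) : P0 != 0 -> a P0 = 0 -> a P = 0 ->
  exists i, P = P0 *+ i.
Proof.
by have [K [uK szK KP]] := kernel_enum; apply: prime_kernel_cyclic l_prime uK szK KP _ _.
Qed.

End Fibres.

(* Reducing c and n modulo F = N(X) - u M(X) in L[u][X] gives, at a generic u,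
   two polynomials of degree < l that are proportional at the l roots of F;
   so they are proportional, and kappa is a quotient of two coefficients. *)
Lemma descend_along_fibres (L : fieldType) (N M c n : {poly L}) l :
    N \is monic -> size N = l.+1 -> (size M <= l)%N -> (0 < l)%N ->
  exists p q : {poly L}, q != 0 /\ forall u kappa (rs : seq L),
    uniq rs -> size rs = l ->
    (forall z, z \in rs ->
      [/\ N.[z] = u * M.[z], n.[z] != 0 & c.[z] = kappa * n.[z]]) ->
    q.[u] != 0 -> kappa = p.[u] / q.[u].
Proof.
move=> monN szN szM l0.
pose F : {poly {poly L}} := N^:P - 'X *: M^:P.
have szXM : (size ('X *: M^:P : {poly {poly L}}) <= l)%N.
  by rewrite (leq_trans (size_scale_leq _ _)) // size_map_polyC.
have szF : size F = l.+1.
  by rewrite size_polyDl size_map_polyC szN // size_polyN ltnS.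
have monF : F \is monic.
  rewrite monicE lead_coefDl; last by rewrite size_map_polyC szN size_polyN ltnS.
  by rewrite lead_coef_map_inj ?(monicP monN) //; apply: polyC_inj.
pose red (b : {poly L}) := Pdiv.Ring.rmodp b^:P F.
pose redu u b := map_poly (horner_eval u) (red b).
have szred b : (size (red b) <= l)%N.
  by rewrite -ltnS -szF Pdiv.Ring.ltn_rmodp monic_neq0.
have redE u z b : N.[z] = u * M.[z] -> (redu u b).[z] = b.[z].
  move=> Nz; pose ev (P : {poly {poly L}}) := horner_eval u P.[z%:P].
  have evE (P : {poly {poly L}}) : (map_poly (horner_eval u) P).[z] = ev P.
    by rewrite -{1}[z](hornerC z u) -/(horner_eval u z%:P) horner_map.
  have evC (b' : {poly L}) : ev b'^:P = b'.[z].
    by rewrite /ev horner_map /= /horner_eval hornerC.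
  rewrite /redu evE -(evC b) [in RHS](Pdiv.RingMonic.rdivp_eq monF b^:P) /ev hornerD hornerM.
  have F0 : horner_eval u F.[z%:P] = 0.
    rewrite /F hornerD hornerN hornerZ !horner_map /= /horner_eval.
    by rewrite hornerD hornerN hornerM !hornerC hornerX Nz subrr.
  by rewrite /horner_eval hornerD hornerM [X in _ * X]F0 mulr0 add0r.
have [n0|n0] := eqVneq (red n) 0.
  exists 0, 1; split=> [|u kappa rs _ szrs rsP _]; first exact: oner_neq0.
  case: rs szrs rsP => [e|z rs _ rsP]; first by rewrite -e in l0.
  have [Nz nz _] := rsP z (mem_head _ _); case/eqP: nz.
  by rewrite -(redE u) // /redu n0 map_poly0 horner0.
pose j := (size (red n)).-1.
exists (red c)`_j, (red n)`_j; split; first by rewrite lead_coef_eq0.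
move=> u kappa rs urs szrs rsP qu.
have prop : redu u c - kappa *: redu u n = 0.
  apply: (@roots_geq_poly_eq0 _ _ rs) => //.
    apply/allP => z /rsP[Nz nz cz]; apply/rootP.
    by rewrite hornerD hornerN hornerZ !redE // cz subrr.
  rewrite szrs (leq_trans (size_polyD _ _)) // geq_max size_polyN.
  rewrite (leq_trans (size_scale_leq _ _)) ?andbT;
  by rewrite (leq_trans (size_poly _ _)) ?szred.
have := congr1 (fun P : {poly L} => P`_j) prop.
rewrite coefB coefZ !coef_map coef0 /= /horner_eval => /eqP.
by rewrite subr_eq0 => /eqP ->; rewrite mulfK.
Qed.

Section EndomorphismShape.
Variables (L : closedFieldType) (E : ecurve L).
Hypothesis two_neq0 : 2%:R != 0 :> L.

Local Notation f := (cubic (ec_a2 E) (ec_a4 E) (ec_a6 E)).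
Local Notation G := (@ecp L E two_neq0).

Lemma size_cubic : size f = 4%N.
Proof.
rewrite /cubic -addrA -addrA size_polyDl size_polyXn //.
rewrite ltnS (leq_trans (size_polyD _ _)) // geq_max; apply/andP; split.
  by rewrite (leq_trans (size_scale_leq _ _)) // size_polyXn.
rewrite (leq_trans (size_polyD _ _)) // geq_max; apply/andP; split.
  by rewrite (leq_trans (size_scale_leq _ _)) // size_polyX.
by rewrite (leq_trans (size_polyC_leq1 _)).
Qed.

Lemma norm_neq0 (a b : {poly L}) : a ^+ 2 - b ^+ 2 * f = 0 -> a = 0 /\ b = 0.
Proof.
move/eqP; rewrite subr_eq0 => /eqP ab.
have [b0|b0] := eqVneq b 0.
  by split=> //; apply/eqP; rewrite -sqrf_eq0 ab b0 expr0n mul0r.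
have a0 : a != 0.
  by rewrite -sqrf_eq0 ab mulf_neq0 ?expf_neq0 ?cubic_neq0.
have := congr1 (fun p : {poly L} => size p) ab.
rewrite expr2 size_mul // expr2 size_mul ?mulf_neq0 ?cubic_neq0 // size_mul //.
rewrite size_cubic; have := size_poly_gt0 a; have := size_poly_gt0 b.
rewrite a0 b0; move: (size a) (size b) => /= i j; lia.
Qed.

(* Multiplying by the conjugate of B makes the denominator a polynomial in x. *)
Lemma regular_quotient (A B : L -> L -> L) : regular E A -> regular E B ->
  (exists x y, Some (x, y) \in on_curve E /\ B x y != 0) ->
  exists (c e n : {poly L}) (S : seq L),
    forall x y, Some (x, y) \in on_curve E -> x \notin S ->
      [/\ n.[x] != 0, B x y != 0 & A x y / B x y = (c.[x] + e.[x] * y) / n.[x]].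
Proof.
move=> [a0 [a1 AE]] [b0 [b1 BE]] [x1 [y1 [c1 Bxy1]]].
pose n := b0 ^+ 2 - b1 ^+ 2 * f.
have n0 : n != 0.
  apply: contraNneq Bxy1 => /norm_neq0[e0 e1].
  by rewrite BE // e0 e1 !hornerE.
have [S nS] := poly_roots n0.
exists (a0 * b0 - a1 * b1 * f), (a1 * b0 - a0 * b1), n, S => x y cxy xS.
have nx : n.[x] != 0 by apply: contraNneq xS => /nS.
have fE := on_curve_cubic cxy.
have nE : n.[x] = (b0.[x] + b1.[x] * y) * (b0.[x] - b1.[x] * y).
  rewrite /n; move: (f) fE => F fE.
  by rewrite !(hornerD, hornerN, horner_exp, hornerM) -fE; ring.
have Bxy : B x y != 0.
  by rewrite BE //; apply: contraNneq nx; rewrite nE => ->; rewrite mul0r.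
split=> //; rewrite BE // in Bxy; rewrite AE // BE //.
have Bxy' : b0.[x] - b1.[x] * y != 0.
  by apply: contraNneq nx; rewrite nE => ->; rewrite mulr0.
rewrite nE; move: (f) fE => F fE.
rewrite !(hornerD, hornerN, hornerM) -fE; field.
by rewrite Bxy Bxy'.
Qed.

(* Averaging over P and - P removes the odd part of the first coordinate and
   the even part of the second. *)
Lemma endomorphism_shape (gamma : point L -> point L) : endomorphism E gamma ->
    given_by_rational_functions E gamma ->
  exists (c n e m : {poly L}) (S : seq L),
    forall x y, Some (x, y) \in on_curve E -> x \notin S ->
      [/\ n.[x] != 0, m.[x] != 0
        & gamma (Some (x, y)) = Some (c.[x] / n.[x], y * (e.[x] / m.[x]))].
Proof.
move=> gamma_end; case: (gamma_end) => homo_gamma _ _.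
move=> [A1 [B1 [A2 [B2 [nB1 nB2 gammaE]]]]].
have rB := @regular_poly2 L E.
have [c [c' [n [S1 xE]]]] := regular_quotient (rB A1) (rB B1) nB1.
have [e' [e [m [S2 yE]]]] := regular_quotient (rB A2) (rB B2) nB2.
exists c, n, e, m, (S1 ++ S2) => x y cxy.
rewrite mem_cat negb_or => /andP[xS1 xS2].
have cNxy : Some (x, - y) \in on_curve E by rewrite -(ec_opp_curve E) /= opprK.
have [nx b1 xE1] := xE _ _ cxy xS1; have [_ b1' xE1'] := xE _ _ cNxy xS1.
have [mx b2 yE2] := yE _ _ cxy xS2; have [_ b2' yE2'] := yE _ _ cNxy xS2.
have g1 := gammaE _ _ cxy b1 b2; have g2 := gammaE _ _ cNxy b1' b2'.
rewrite xE1 yE2 in g1; rewrite xE1' yE2' in g2.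
have gN : gamma (Some (x, - y)) = ec_opp (gamma (Some (x, y))).
  pose P : G := Sub (Some (x, y)) cxy.
  have := congr1 val (morphN (@ecp_liftD _ E two_neq0 _ gamma_end) P).
  by rewrite val_ecpN !val_ecp_lift.
rewrite g1 g2 /= in gN; case: gN => gx gy; split=> //; rewrite g1.
congr (Some (_, _)).
  apply: (mulfI two_neq0); rewrite !mulr_natl !mulr2n -{2}gx; field.
  by rewrite nx.
apply: (mulfI two_neq0); rewrite !mulr_natl !mulr2n.
rewrite -[X in _ + X]opprK -gy; field.
by rewrite mx.
Qed.

End EndomorphismShape.

(** * Divisibility by alpha *)

Section Factorization.
Variables (L : closedFieldType) (E : ecurve L).
Hypothesis two_neq0 : 2%:R != 0 :> L.
Variables (p l : nat).
Hypothesis p_char : p \in [pchar L].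
Hypothesis l_prime : prime l.
Variables (alpha : point L -> point L) (r s : ratfun L).
Hypothesis alpha_end : endomorphism E alpha.
Hypothesis alpha_rs : standard_form E alpha r s.
Hypothesis alpha_deg : ratfun_degree r = l.

Local Notation f := (cubic (ec_a2 E) (ec_a4 E) (ec_a6 E)).
Local Notation N := (rnum r).
Local Notation M := (rden r).
Local Notation G := (@ecp L E two_neq0).
Local Notation a := (@ecp_lift L E two_neq0 alpha).

Hypothesis ker_neq0 : exists2 P0 : G, P0 != 0 & a P0 = 0.

Let aD : {morph a : P Q / P + Q} := ecp_liftD alpha_end.
Let homo_alpha : {homo alpha : P / P \in on_curve E}.
Proof. by case: alpha_end. Qed.

Lemma horner_polyC2 (h : {poly L}) x y : (h^:P).[x%:P].[y] = h.[x].
Proof. by rewrite horner_map hornerC. Qed.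

Section Quotient.
Variable gamma : point L -> point L.
Hypothesis gamma_end : endomorphism E gamma.
Local Notation g := (@ecp_lift L E two_neq0 gamma).
Hypothesis ker_sub : forall P : G, a P = 0 -> g P = 0.

Let gD : {morph g : P Q / P + Q} := ecp_liftD gamma_end.
Let homo_gamma : {homo gamma : P / P \in on_curve E}.
Proof. by case: gamma_end. Qed.

Fact alpha_surjb (Q : G) : exists P, a P == Q.
Proof.
have [P aP] := alpha_surj l_prime alpha_end alpha_rs alpha_deg ker_neq0 Q.
by exists P; apply/eqP.
Qed.

Definition quotient_lift (Q : G) : G := g (xchoose (alpha_surjb Q)).

Lemma quotient_liftE P : quotient_lift (a P) = g P.
Proof.
apply/eqP; rewrite -subr_eq0 -(morphB gD); apply/eqP/ker_sub.
by rewrite (morphB aD) (eqP (xchooseP (alpha_surjb (a P)))) subrr.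
Qed.

Lemma quotient_liftD : {morph quotient_lift : P Q / P + Q}.
Proof.
move=> P Q; have [P' /eqP<-] := alpha_surjb P; have [Q' /eqP<-] := alpha_surjb Q.
by rewrite -aD !quotient_liftE gD.
Qed.

Definition quotient_map (Q : point L) : point L :=
  val (quotient_lift (insubd (0 : G) Q)).

Lemma quotient_mapE P : P \in on_curve E -> quotient_map (alpha P) = gamma P.
Proof.
move=> cP; pose P' : G := Sub P cP.
have -> : alpha P = val (a P') by rewrite val_ecp_lift.
by rewrite /quotient_map valKd quotient_liftE val_ecp_lift.
Qed.

Lemma quotient_map_rational : given_by_rational_functions E gamma ->
  given_by_rational_functions E quotient_map.
Proof.
move=> gamma_rat.
have [c [n [e [m [S gammaE]]]]] := endomorphism_shape two_neq0 gamma_end gamma_rat.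
have [S0 fib] :=
  generic_fibre p_char l_prime alpha_end alpha_rs alpha_deg ker_neq0.
have [t ft] := poly_roots (cubic_neq0 E).
have szN := size_num alpha_end alpha_rs alpha_deg ker_neq0.
have szM := size_den alpha_end alpha_rs alpha_deg ker_neq0.
have lN0 : (lead_coef N)^-1 != 0.
  by rewrite invr_eq0 lead_coef_eq0 -size_poly_gt0 szN.
pose N1 := (lead_coef N)^-1 *: N; pose M1 := (lead_coef N)^-1 *: M.
have monN1 : N1 \is monic.
  by rewrite monicE lead_coefZ mulVf // -invr_eq0.
have szN1 : size N1 = l.+1 by rewrite size_scale.
have szM1 : (size M1 <= l)%N by rewrite size_scale.
have [p1 [q1 [q10 desc1]]] :=
  descend_along_fibres c n monN1 szN1 szM1 (prime_gt0 l_prime).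
have [p2 [q2 [q20 desc2]]] :=
  descend_along_fibres (e * rden s) (m * rnum s) monN1 szN1 szM1 (prime_gt0 l_prime).
pose S' := S0 ++ t ++ [seq N.[x] / M.[x] | x <- S].
have generic u v : Some (u, v) \in on_curve E -> u \notin S' ->
    q1.[u] != 0 -> q2.[u] != 0 ->
  quotient_map (Some (u, v)) = Some (p1.[u] / q1.[u], v * (p2.[u] / q2.[u])).
  move=> cuv; rewrite !mem_cat !negb_or => /and3P[uS0 ut uS] q1u q2u.
  have [rs [urs szrs rsP _]] := fib u v cuv uS0.
  have v0 : v != 0.
    apply: contraNneq ut => v0; apply: ft.
    by rewrite -(on_curve_cubic cuv) v0 expr0n.
  have rsE z : z \in rs -> [/\ N1.[z] = u * M1.[z], n.[z] != 0,
      (m * rnum s).[z] != 0 & quotient_map (Some (u, v)) =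
      Some (c.[z] / n.[z], v * ((e * rden s).[z] / (m * rnum s).[z]))].
    move=> /rsP[Mz Nz nz dz [cz az]].
    have zS : z \notin S.
      apply: contra uS => zS; apply/mapP; exists z => //.
      by rewrite Nz mulfK.
    have [nz0 mz0 gz] := gammaE _ _ cz zS.
    split=> //; first by rewrite !hornerZ Nz mulrCA.
      by rewrite hornerM mulf_neq0.
    rewrite -az quotient_mapE // gz !hornerM; congr (Some (_, _)).
    by field; rewrite nz dz mz0.
  have [x0 x0rs] : exists x0, x0 \in rs.
    case: (rs) szrs => [l0|x1 rs' _]; last by exists x1; rewrite mem_head.
    by have := prime_gt0 l_prime; rewrite -l0.
  have [_ _ _ qE] := rsE _ x0rs; rewrite qE; congr (Some (_, _ * _)).
    apply: (desc1 u _ rs) => // z zrs; have [Nz nz _] := rsE _ zrs.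
    by rewrite qE => -[-> _]; split=> //; rewrite mulfVK.
  apply: (desc2 u _ rs) => // z zrs; have [Nz _ nz] := rsE _ zrs.
  by rewrite qE => -[_ /(mulfI v0) ->]; split=> //; rewrite mulfVK.
pose Z := (\prod_(b <- S') ('X - b%:P)) * (q1 * q2).
have ZE u : Z.[u] != 0 -> [/\ u \notin S', q1.[u] != 0 & q2.[u] != 0].
  rewrite !hornerM !mulf_eq0 !negb_or => /and3P[ZS -> ->]; split=> //.
  by apply: contra ZS; rewrite -root_prod_XsubC => /rootP->.
have Z0 : Z != 0.
  by rewrite !mulf_neq0 // -size_poly_gt0 size_prod_XsubC.
have [tZ ZtZ] := poly_roots Z0.
have [u0 u0Z] := closed_field_infinite tZ.
have [v0 cuv0] := on_curve_exists E u0.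
have Zu0 : Z.[u0] != 0 by apply: contra u0Z => /eqP/ZtZ.
exists (p1 * Z)^:P, (q1 * Z)^:P, ((p2 * Z)^:P * ('X : {poly L})%:P), (q2 * Z)^:P.
have [_ q1u0 q2u0] := ZE _ Zu0.
split; first by exists u0, v0; split=> //; rewrite horner_polyC2 hornerM mulf_neq0.
  by exists u0, v0; split=> //; rewrite horner_polyC2 hornerM mulf_neq0.
move=> u v cuv; rewrite !horner_polyC2 => qZ _.
have Zu : Z.[u] != 0.
  by apply: contraNneq qZ => Zu; rewrite hornerM Zu mulr0.
have [uS' q1u q2u] := ZE _ Zu; rewrite (generic _ _ cuv) //.
have -> : ((p2 * Z)^:P * ('X : {poly L})%:P).[u%:P].[v] = (p2 * Z).[u] * v.
  by rewrite hornerM hornerC hornerM horner_polyC2 hornerX.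
rewrite (hornerM p1) (hornerM q1) (hornerM p2) (hornerM q2).
by congr (Some (_, _)); field; rewrite Zu ?q1u ?q2u.
Qed.

Lemma factor_through : exists gamma', endomorphism E gamma' /\
  {in on_curve E, gamma =1 gamma' \o alpha}.
Proof.
case: (gamma_end) => _ _ [gamma0|gamma_rat].
  exists (fun=> None); split; last exact: gamma0.
  by split=> //; left.
exists quotient_map; split; last by move=> P cP /=; rewrite quotient_mapE.
split; last by right; apply: quotient_map_rational.
  by move=> P _; apply: valP.
move=> P Q cP cQ; rewrite /quotient_map -val_ecpD -quotient_liftD.
congr (val (quotient_lift _)); apply: val_inj.
by rewrite val_ecpD !val_insubd cP cQ ec_add_curve.
Qed.

End Quotient.

End Factorization.

(** * Trees of a quotient by a sign *)

Section TreeOfQuotient.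
Variables (M : zmodType) (T : eqType) (xc : M -> T) (V V0 : {pred T}).
Variables (a sg g : M -> M) (rr : T -> T) (k0 : nat).
Hypothesis xc_surj : forall u, exists P, xc P = u.
Hypothesis xc_eq : forall P Q, xc P = xc Q <-> P = Q \/ P = - Q.
Hypothesis aD : {morph a : P Q / P + Q}.
Hypothesis sgD : {morph sg : P Q / P + Q}.
Hypothesis gD : {morph g : P Q / P + Q}.
Hypothesis a_sg : forall P, a (sg P) = sg (a P).
Hypothesis a_g : forall P, a (g P) = g (a P).
Hypothesis rr_xc : forall P, rr (xc P) = xc (a P).
Hypothesis in_V : forall P,
  xc P \in V <-> sg (sg P) = P \/ sg (sg P) = - P.
Hypothesis in_V0 : forall P, xc P \in V0 -> sg P = P \/ sg P = - P.
Hypothesis a_surj : forall Q, exists P, a P = Q.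
Hypothesis ker_sg : forall P, a P = 0 -> sg P = P.
Hypothesis ker_neq0 : exists2 P, P != 0 & a P = 0.
Hypothesis ker_two : forall P, a (a P) = 0 -> P *+ 2 = 0 -> a P = 0.
Hypothesis valuation : forall P, sg (sg P) - P = iter k0 a (g P).
Hypothesis ker_g : forall P, a P = 0 -> g P = 0 -> P = 0.

Local Notation rho P := (sg (sg P)).

Let iter_aD n := iter_morphD n aD.

Let rho_iter n P : rho (iter n a P) = iter n a (rho P).
Proof. by elim: n => //= n <-; rewrite !a_sg. Qed.

Let rhoD : {morph (fun P => rho P) : P Q / P + Q}.
Proof. by move=> P Q; rewrite !sgD. Qed.

Let iter_xc n P : iter n rr (xc P) = xc (iter n a P).
Proof. by elim: n => //= n ->; rewrite rr_xc. Qed.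

Let iter_g n P : iter n a (g P) = g (iter n a P).
Proof. by elim: n => //= n ->; rewrite a_g. Qed.

Let iter_fix c j P : iter c a P = P -> iter (j * c) a P = P.
Proof. by move=> cP; elim: j => //= j ih; rewrite mulSn iterD ih. Qed.

Let periodic_point P : periodic rr (xc P) ->
  exists2 c, (0 < c)%N & iter c a P = P.
Proof.
case=> c c0; rewrite iter_xc => /xc_eq[] cP; first by exists c.
by exists (c + c)%N; rewrite ?addn_gt0 ?c0 // iterD !cP (morphN (iter_aD c)) cP opprK.
Qed.

Let point_periodic c P : (0 < c)%N -> iter c a P = P -> periodic rr (xc P).
Proof. by move=> c0 cP; exists c => //; rewrite iter_xc cP. Qed.

Let periodic_nilpotent c m P :
  (0 < c)%N -> iter c a P = P -> iter m a P = 0 -> P = 0.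
Proof.
move=> c0 cP mP; rewrite -(iter_fix m cP).
have -> : (m * c = (m * c - m) + m)%N by nia.
by rewrite iterD mP (morph0 (iter_aD _)).
Qed.

Let iter_lt_eq0 m n P : (m <= n)%N -> iter m a P = 0 -> iter n a P = 0.
Proof. by move=> /subnK<- mP; rewrite iterD mP (morph0 (iter_aD _)). Qed.

Let nilpotent_fixed P : iter k0 a P = 0 -> rho P = P.
Proof.
by move=> kP; apply/eqP; rewrite -subr_eq0 valuation iter_g kP (morph0 gD).
Qed.

Let fixed_nilpotent m P : rho P = P -> iter m a P = 0 -> iter k0 a P = 0.
Proof.
have step Q : rho Q = Q -> iter k0.+1 a Q = 0 -> iter k0 a Q = 0.
  by move=> rQ aQ; apply: ker_g => //; rewrite -iter_g -valuation rQ subrr.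
move=> rP; elim: m => [P0|m ih mP]; first exact: iter_lt_eq0 (leq0n _) P0.
have [lt|ge] := leqP m.+1 k0; first exact: iter_lt_eq0 lt mP.
apply: ih; have -> : m = (k0 + (m - k0))%N by lia.
rewrite iterD; apply: step; first by rewrite rho_iter rP.
by rewrite -iterD; have -> : (k0.+1 + (m - k0) = m.+1)%N by lia.
Qed.

(* With e := sg P - P one has 2 (P + e) = 0 as soon as rho P = - P. *)
Let antifixed_nilpotent m P : rho P = - P -> iter m a P = 0 -> a P = 0.
Proof.
have step Q : rho Q = - Q -> a (a Q) = 0 -> a Q = 0.
  move=> rQ aaQ; set e := sg Q - Q.
  have ae : a e = 0.
    by rewrite /e (morphB aD) a_sg (ker_sg aaQ) subrr.
  have sgQ : sg Q = Q + e by rewrite /e addrC subrK.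
  have : a (Q + e) = 0.
    apply: ker_two; first by rewrite aD ae addr0.
    have : rho Q = Q + e + e by rewrite sgQ sgD sgQ (ker_sg ae).
    by rewrite rQ => rQE; rewrite mulr2n [X in _ + X]addrC addrA -rQE addNr.
  by rewrite aD ae addr0.
move=> rP; elim: m => [/= ->|[|m] ih mP]; [by rewrite (morph0 aD) | exact: mP |].
apply: ih => /=; apply: step => //.
by rewrite rho_iter rP (morphN (iter_aD m)).
Qed.

Variable xt : T.
Hypothesis xt_V0 : xt \in V0.
Hypothesis xt_per : periodic rr xt.

Let root_fixed Q : xc Q = xt -> rho Q = Q.
Proof.
move=> e; have := xt_V0; rewrite -e => /in_V0[] sQ; rewrite !sQ //.
by rewrite (morphN sgD) sQ opprK.
Qed.

Let back_periodic m Q : periodic rr (xc Q) ->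
  exists R c, [/\ (0 < c)%N, iter c a R = R, iter m a R = Q &
                  exists n, R = iter n a Q].
Proof.
move=> /periodic_point[c c0 cQ]; exists (iter (m * c - m) a Q), c; split=> //.
- by rewrite -iterD addnC iterD cQ.
- by rewrite -iterD subnKC ?leq_pmulr // iter_fix.
- by exists (m * c - m)%N.
Qed.

Let tree_point m x : x \in V -> iter m rr x = xt ->
  exists P1 P2, [/\ xc (P1 + P2) = x, iter m a P1 = 0,
    exists2 c, (0 < c)%N & iter c a P2 = P2, rho P1 = P1 & rho P2 = P2].
Proof.
have [P <-] := xc_surj x => VP; rewrite iter_xc => mP.
have Qper : periodic rr (xc (iter m a P)) by rewrite mP.
have rQ := root_fixed mP.
have [P2 [c [c0 cP2 mP2 [n P2E]]]] := back_periodic m Qper.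
have rP2 : rho P2 = P2 by rewrite P2E rho_iter rQ.
exists (P - P2), P2; rewrite subrK (morphB (iter_aD m)) mP2 subrr.
split=> //; first by exists c.
case/in_V: VP => rP; first by rewrite (morphB rhoD) rP rP2.
have NP2 : - P2 = P2.
  by rewrite -[RHS]rP2 P2E rho_iter rho_iter rP !(morphN (iter_aD _)).
have rP1 : rho (P - P2) = - (P - P2).
  by rewrite (morphB rhoD) rP rP2 opprB addrC NP2.
have aP1 : a (P - P2) = 0.
  by apply: (@antifixed_nilpotent m) rP1 _; rewrite (morphB (iter_aD m)) mP2 subrr.
by rewrite !(ker_sg aP1).
Qed.

Let xc_inV P : rho P = P -> xc P \in V.
Proof. by move=> rP; apply/in_V; left. Qed.

Let nilpotent_exact k : exists2 P, iter k a P = 0 &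
  forall j, (j < k)%N -> iter j a P <> 0.
Proof.
elim: k => [|[|k] [P kP jP]]; first by exists 0.
  by have [P0 /eqP nP0 aP0] := ker_neq0; exists P0 => // [[]].
have [Q aQ] := a_surj P; exists Q; first by rewrite iterSr aQ.
case=> [_ /= Q0|j ljk]; last by rewrite iterSr aQ; apply: jP.
by apply: (jP 0%N) => //=; rewrite -aQ Q0 (morph0 aD).
Qed.

Let in_tree_nilpotent P1 P2 c : (0 < c)%N -> iter c a P2 = P2 ->
  periodic rr (xc (P1 + P2)) -> (exists m, iter m a P1 = 0) -> P1 = 0.
Proof.
move=> c0 cP2 /periodic_point[c' c'0 c'P] [m mP1].
apply: (@periodic_nilpotent (c' * c) m) mP1; first by rewrite muln_gt0 c'0.
have := iter_fix c c'P; rewrite (iter_aD (c * c')) mulnC (iter_fix c' cP2).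
exact: addIr.
Qed.

Lemma quotient_tree :
  tree_depth V rr xt k0 /\ forall x, tree_leaf V rr xt x -> height rr xt x k0.
Proof.
have bound x m : in_tree V rr xt x -> height rr xt x m -> (m <= k0)%N.
  case=> xV [->|[_ [m' [m'x np]]]] [mx nm].
    by case: m mx nm => // m _ /(_ 0%N isT).
  have lemm' : (m <= m')%N by rewrite leqNgt; apply/negP => /nm.
  apply: leq_trans lemm' _.
  have [P1 [P2 [xE mP1 [c c0 cP2] rP1 _]]] := tree_point xV m'x.
  have kP1 := fixed_nilpotent rP1 mP1.
  rewrite leqNgt; apply/negP => /np; apply.
  rewrite -xE iter_xc (iter_aD k0) kP1 add0r.
  by apply: (point_periodic c0); rewrite -iterD addnC iterD cP2.
split; first split=> //.
  have [Q QE] := xc_surj xt.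
  have Qper : periodic rr (xc Q) by rewrite QE.
  have rQ := root_fixed QE.
  have [P2 [c [c0 cP2 kP2 [n P2E]]]] := back_periodic k0 Qper.
  have [P1 kP1 nP1] := nilpotent_exact k0.
  have rP : rho (P1 + P2) = P1 + P2.
    by rewrite rhoD (nilpotent_fixed kP1) P2E rho_iter rQ.
  have kx : iter k0 rr (xc (P1 + P2)) = xt.
    by rewrite iter_xc (iter_aD k0) kP1 add0r kP2.
  have np j : (j < k0)%N -> ~ periodic rr (iter j rr (xc (P1 + P2))).
    move=> jk; rewrite iter_xc (iter_aD j).
    have cjP2 : iter c a (iter j a P2) = iter j a P2.
      by rewrite -iterD addnC iterD cP2.
    move/(in_tree_nilpotent c0 cjP2) => j0; apply: (nP1 j jk); apply: j0.
    by exists (k0 - j)%N; rewrite -iterD subnK // ltnW.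
  exists (xc (P1 + P2)); split; last first.
    by split=> // j /np; apply: contra_not => ->.
  split; first exact: xc_inV.
  have [k00|k00] := posnP k0; first by left; rewrite -kx k00.
  by right; split; [apply: (np 0%N) | exists k0].
move=> x [[xV [->|[nx [m [mx np]]]]] leaf].
  have [Q QE] := xc_surj xt.
  have Qper : periodic rr (xc Q) by rewrite QE.
  have [P2 [c [c0 cP2 kP2 [n P2E]]]] := back_periodic 1 Qper.
  case: (leaf (xc P2)); last by rewrite rr_xc -QE -kP2.
  by apply: xc_inV; rewrite P2E rho_iter (root_fixed QE).
have [P1 [P2 [xE mP1 [c c0 cP2] rP1 rP2]]] := tree_point xV mx.
have kP1 := fixed_nilpotent rP1 mP1.
have mk : (m <= k0)%N.
  rewrite leqNgt; apply/negP => /np; apply.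
  rewrite -xE iter_xc (iter_aD k0) kP1 add0r.
  by apply: (point_periodic c0); rewrite -iterD addnC iterD cP2.
have [mk0|nmk0] := eqVneq m k0; last first.
  have ltmk : (m < k0)%N by rewrite ltn_neqAle nmk0.
  have [R1 aR1] := a_surj P1.
  have kR1 : iter k0 a R1 = 0.
    by apply: iter_lt_eq0 ltmk _; rewrite iterSr aR1.
  have P2per := point_periodic c0 cP2.
  have [R2 [c' [c'0 cR2 aR2 [n R2E]]]] := back_periodic 1 P2per.
  case: (leaf (xc (R1 + R2))); last by rewrite rr_xc aD aR1 -xE -aR2.
  by apply: xc_inV; rewrite rhoD (nilpotent_fixed kR1) R2E rho_iter rP2.
by rewrite -mk0; split=> // j /np; apply: contra_not => ->.
Qed.

End TreeOfQuotient.

(** * Imaginary quadratic orders *)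

Lemma int_not_ramified_at_two (d s m t z1 z2 : int) : odd `|d|%N ->
  d = s ^+ 2 - 4%:R * m -> coprime `|z1|%N `|z2|%N ->
  d * z1 ^+ 2 = z2 ^+ 2 * (t ^+ 2 - 2%:R) -> False.
Proof.
have parity (x : int) : exists k, x = 2%:R * k \/ x = 2%:R * k + 1.
  exists (x %/ 2)%Z; have := divz_eq x 2; have := @ltz_pmod x 2 isT.
  by have := @modz_ge0 x 2 isT; lia.
have [ks sE] := parity s; have [kt tE] := parity t.
have [k1 z1E] := parity z1; have [k2 z2E] := parity z2.
move=> od dE co eqd.
have sodd : s = 2%:R * ks + 1.
  case: sE => // sE; move: od; rewrite dE sE.
  have -> : (2%:R * ks) ^+ 2 - 4%:R * m = 2%:R * (2%:R * ks ^+ 2 - 2%:R * m) by ring.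
  by rewrite abszM oddM.
have dE4 : d = 1 + 4%:R * (ks ^+ 2 + ks - m) by rewrite dE sodd; ring.
move: (ks ^+ 2 + ks - m) dE4 => e {}dE.
case: z2E => z2E; last first.
  move: eqd; rewrite dE z2E.
  case: z1E => ->; case: tE => ->; rewrite !expr2; lia.
case: z1E => z1E; last by move: eqd; rewrite dE z2E z1E !expr2; lia.
by move: co; rewrite z1E z2E !abszM /coprime -muln_gcdr muln_eq1.
Qed.

Section FieldNorm.
Variable K : fieldExtType rat.
Local Notation n := (\dim {:K}).
Local Notation mat e z := (passmx.mxof e e (amull z)).
Implicit Types (e : n.-tuple K) (z : K).

Lemma mxof_similar e e' (phi : 'End(K)) : basis_of fullv e -> basis_of fullv e' ->
  exists P Q, P *m Q = 1%:M /\ passmx.mxof e e phi = P *m passmx.mxof e' e' phi *m Q.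
Proof.
move=> be be'; exists (passmx.mxof e e' \1), (passmx.mxof e' e \1).
rewrite -!passmx.mxof_comp // ?comp_lfun1l ?comp_lfun1r.
by rewrite passmx.mxof1 ?(basis_free be).
Qed.

Lemma trace_basis e z : basis_of fullv e -> field_trace z = \tr (mat e z).
Proof.
move=> be; have [P [Q [PQ e1]]] := mxof_similar (amull z) (vbasisP _) be.
by rewrite /field_trace e1 -mulmxA mxtrace_mulC -mulmxA (mulmx1C PQ) mulmx1.
Qed.

Definition field_norm z : rat := \det (mat (vbasis {:K}) z).

Lemma norm_basis e z : basis_of fullv e -> field_norm z = \det (mat e z).
Proof.
move=> be; have [P [Q [PQ e1]]] := mxof_similar (amull z) (vbasisP _) be.
rewrite /field_norm e1 !det_mulmx mulrAC -det_mulmx PQ det1.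
by rewrite mul1r.
Qed.

Lemma field_normM z z' : field_norm (z * z') = field_norm z * field_norm z'.
Proof.
rewrite /field_norm mulrC -det_mulmx -passmx.mxof_comp ?vbasisP //.
congr (\det (passmx.mxof _ _ _)); apply/lfunP => v.
by rewrite !lfunE /= !lfunE /= mulrA.
Qed.

Lemma mat_entry e z i j : mat e z i j = coord e j (z * e`_i).
Proof.
by rewrite mxE /= passmx.vecof_delta !mxE lfunE.
Qed.

Lemma Zbasis_mem (O : K -> Prop) (w : n.-tuple K) i : Zbasis O w -> O (tnth w i).
Proof.
case=> _ Ow; apply/Ow; exists (fun j => (j == i)%:R); rewrite (bigD1 i) //= eqxx mul1r.
by rewrite big1 ?addr0 // => j /negPf->; rewrite mul0r.
Qed.

Lemma order_sub (O : K -> Prop) z z' : is_order O -> O z -> O z' -> O (z - z').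
Proof.
case=> _ _ [w [_ Ow]] /Ow[c ->] /Ow[c' ->]; apply/Ow; exists (fun i => c i - c' i).
by rewrite -sumrB; apply: eq_bigr => i _; rewrite /= intrB mulrBl.
Qed.

Lemma order_int (O : K -> Prop) (t : int) : is_order O -> O t%:~R.
Proof.
case=> O1 _ [w [_ Ow]]; have /Ow[c E1] := O1; apply/Ow; exists (fun i => t * c i).
have -> : t%:~R = t%:~R * \sum_i (c i)%:~R * tnth w i :> K by rewrite -E1 mulr1.
by rewrite mulr_sumr; apply: eq_bigr => i _; rewrite /= intrM mulrA.
Qed.

Lemma order_mat_int (O : K -> Prop) : is_order O -> forall z, O z ->
  exists2 e : n.-tuple K, basis_of fullv e & exists C : 'M[int]_n, mat e z = map_mx intr C.
Proof.
case=> _ OM [w Zw] z Oz; have [bw Ow] := Zw; exists w => //.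
have ex i : exists c : {ffun 'I_n -> int},
    z * tnth w i = \sum_j (c j)%:~R * tnth w j.
  have [c cE] := (Ow _).1 (OM _ _ Oz (Zbasis_mem i Zw)).
  by exists (finfun c); rewrite cE; apply: eq_bigr => j _; rewrite ffunE.
have [c cE] := fin_all_exists ex.
exists (\matrix_(i, j) c i j); apply/matrixP => i j; rewrite mat_entry !mxE.
rewrite -tnth_nth cE.
have -> : \sum_j (c i j)%:~R * tnth w j = \sum_j (c i j)%:~R *: w`_j :> K.
  by apply: eq_bigr => k _; rewrite -tnth_nth scaler_int mulrzl.
by rewrite coord_sum_free ?(basis_free bw).
Qed.

Lemma order_trace_int (O : K -> Prop) z : is_order O -> O z ->
  exists t : int, field_trace z = t%:~R.
Proof.
move=> oO Oz; have [e be [C CE]] := order_mat_int oO Oz.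
by exists (\tr C); rewrite (trace_basis _ be) CE raddf_sum; apply: eq_bigr => i _; rewrite mxE.
Qed.

Lemma order_norm_int (O : K -> Prop) z : is_order O -> O z ->
  exists d : int, field_norm z = d%:~R.
Proof.
move=> oO Oz; have [e be [C CE]] := order_mat_int oO Oz.
by exists (\det C); rewrite (norm_basis _ be) CE det_map_mx.
Qed.

End FieldNorm.

Section ImaginaryQuadratic.
Import Order.TTheory Num.Theory.
Variables (K : fieldExtType rat) (D : int) (sqrtD : K).
Hypothesis D_lt0 : (D < 0)%R.
Hypothesis sqrtD_sqr : sqrtD ^+ 2 = D%:~R.
Hypothesis K_gen : <<1; sqrtD>>%VS = {:K}%VS.

Local Notation n := (\dim {:K}).
Local Notation "'D_rat'" := (D%:~R : rat).
Definition quad (x y : rat) : K := x *: 1 + y *: sqrtD.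

Lemma quadD x y x' y' : quad x y + quad x' y' = quad (x + x') (y + y').
Proof. by rewrite /quad addrACA -!scalerDl. Qed.

Lemma sqrtD_mul : sqrtD * sqrtD = D_rat *: 1.
Proof. by rewrite -expr2 sqrtD_sqr scaler_int. Qed.

Lemma quadM x y x' y' :
  quad x y * quad x' y' = quad (x * x' + D_rat * y * y') (x * y' + y * x').
Proof.
rewrite /quad mulrDl !mulrDr -!scalerAl -!scalerAr !mul1r mulr1 sqrtD_mul !scalerA.
rewrite addrACA [X in _ + X]addrC addrACA -!scalerDl.
by congr (_ *: _ + _ *: _); ring.
Qed.

Lemma quad_gen z : exists x y, z = quad x y.
Proof.
have : z \in <<1; sqrtD>>%VS by rewrite K_gen memvf.
case/Fadjoin1_polyP => q ->; elim/poly_ind: q => [|q c [x [y e]]].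
  by exists 0, 0; rewrite rmorph0 horner0 /quad !scale0r addr0.
exists (D_rat * y + c), x; rewrite rmorphD rmorphM /= map_polyX map_polyC /=.
rewrite hornerD hornerM hornerX hornerC e.
have -> : sqrtD = quad 0 1 by rewrite /quad scale0r scale1r add0r.
rewrite [X in _ + X](_ : _ = quad c 0); last by rewrite /quad scale0r addr0.
by rewrite quadM quadD; congr quad; ring.
Qed.

Lemma quad_eq0 x y : quad x y = 0 -> x = 0 /\ y = 0.
Proof.
move=> q0; have : quad x y * quad x (- y) = 0 by rewrite q0 mul0r.
rewrite quadM /quad.
have -> : x * - y + y * x = 0 by ring.
rewrite scale0r addr0 => /eqP; rewrite scaler_eq0 oner_eq0 orbF => /eqP N0.
have D0 : D_rat < 0 by rewrite ltrz0.
have y0 : y = 0.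
  apply/eqP; apply: contraT => y0; have : 0 < y ^+ 2 by rewrite exprn_even_gt0 ?y0 ?orbT.
  have : 0 <= x ^+ 2 by apply: sqr_ge0.
  rewrite !expr2; nra.
by split=> //; move: N0; rewrite y0 oppr0 mulr0 addr0 => /eqP; rewrite mulf_eq0 => /orP[] /eqP.
Qed.

Lemma quad_inj x y x' y' : quad x y = quad x' y' -> x = x' /\ y = y'.
Proof.
move/eqP; rewrite -subr_eq0 /quad opprD addrACA -!scalerBl => /eqP/quad_eq0[].
by move/eqP; rewrite subr_eq0 => /eqP-> /eqP; rewrite subr_eq0 => /eqP->.
Qed.

Lemma quad_basis : basis_of {:K} [:: 1; sqrtD].
Proof.
rewrite /basis_of; apply/andP; split.
  apply/eqP/vspaceP => z; rewrite memvf; have [x [y ->]] := quad_gen z.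
  by rewrite /quad memvD ?memvZ ?memv_span ?inE ?eqxx ?orbT.
rewrite free_cons span_seq1 seq1_free; apply/andP; split.
  apply/negP => /vlineP[k e].
  have [|/eqP] := @quad_eq0 1 (- k); last by rewrite oner_eq0.
  by rewrite /quad scale1r scaleNr -e subrr.
apply/negP => /eqP sD0; have [|_ /eqP] := @quad_eq0 0 1.
  by rewrite /quad scale0r scale1r add0r.
by rewrite oner_eq0.
Qed.

Lemma dim_quad : n = 2.
Proof. exact: (@size_basis _ _ _ 2 [tuple 1; sqrtD] quad_basis). Qed.

Lemma ord_two m : m = 2 -> exists i0 i1 : 'I_m,
  [/\ val i0 = 0%N, val i1 = 1%N,
    forall A : 'M[rat]_m, \tr A = A i0 i0 + A i1 i1 &
    forall A : 'M[rat]_m, \det A = A i0 i0 * A i1 i1 - A i0 i1 * A i1 i0].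
Proof.
move=> ->; exists 0, 1; split=> // A.
  by rewrite /mxtrace big_ord_recl big_ord1; congr (A _ _ + A _ _); apply: val_inj.
rewrite (expand_det_row A 0) big_ord_recl big_ord1 /cofactor !det_mx11 !mxE /=.
rewrite expr0 expr1 mul1r mulN1r mulrN.
by congr (A _ _ * A _ _ - A _ _ * A _ _); apply: val_inj.
Qed.

Lemma quad_trace_norm x y :
  field_trace (quad x y) = 2%:R * x /\ field_norm (quad x y) = x ^+ 2 - D_rat * y ^+ 2.
Proof.
have szb : size [:: 1; sqrtD] == n by rewrite dim_quad.
pose e : n.-tuple K := Tuple szb.
have be : basis_of {:K} e by apply: quad_basis.
rewrite (trace_basis _ be) (norm_basis _ be).
have [i0 [i1 [i0E i1E trE detE]]] := ord_two dim_quad.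
have e0 : e`_i0 = 1 by rewrite i0E.
have e1 : e`_i1 = sqrtD by rewrite i1E.
have n01 : i0 != i1 by apply/eqP => e01; move: i0E; rewrite e01 i1E.
have cE a b : coord e i0 (quad a b) = a /\ coord e i1 (quad a b) = b.
  rewrite /quad -e0 -e1 !linearD !linearZ /= !coord_free ?(basis_free be) //.
  by rewrite !eqxx eq_sym (negPf n01) !mulr1 !mulr0 addr0 add0r.
rewrite trE detE !mat_entry e0 e1 mulr1.
have -> : quad x y * sqrtD = quad (D_rat * y) x.
  have -> : sqrtD = quad 0 1 by rewrite /quad scale0r scale1r add0r.
  by rewrite quadM; congr quad; ring.
have [-> ->] := cE x y; have [-> ->] := cE (D_rat * y) x.
by split; ring.
Qed.

(* Stickelberger: the discriminant is s^2 - 4 N(w0) N(w1), where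
   s = T(w0) T(w1) - T(w0 w1). *)
Lemma discriminant_shape dK : is_discriminant K dK -> exists (s m : int) (v : rat),
  dK = s ^+ 2 - 4%:R * m /\ dK%:~R = D_rat * v ^+ 2.
Proof.
move=> [O [w [[oO _] Zw dE]]].
have [i0 [i1 [_ _ _ detE]]] := ord_two dim_quad.
rewrite detE !mxE in dE.
have Ow i : O (tnth w i) by apply: Zbasis_mem.
have [_ OM _] := oO.
have [t0 T0] := order_trace_int oO (Ow i0); have [t1 T1] := order_trace_int oO (Ow i1).
have [t01 T01] := order_trace_int oO (OM _ _ (Ow i0) (Ow i1)).
have [n0 N0] := order_norm_int oO (Ow i0); have [n1 N1] := order_norm_int oO (Ow i1).
have [x0 [y0 w0E]] := quad_gen (tnth w i0); have [x1 [y1 w1E]] := quad_gen (tnth w i1).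
move: dE T0 T1 T01 N0 N1; rewrite w0E w1E !quadM.
rewrite !(quad_trace_norm _ _).1 !(quad_trace_norm _ _).2 => dE T0 T1 T01 N0 N1.
exists (t0 * t1 - t01), (n0 * n1), (2%:R * (x0 * y1 - x1 * y0)); split.
  apply/eqP; rewrite -(eqr_int rat); apply/eqP.
  rewrite dE expr2 !(intrB, intrM) -T0 -T1 -T01 -N0 -N1; ring.
by rewrite dE; ring.
Qed.

Lemma order_two_unit (O : K -> Prop) a b dK : is_order O -> O a -> O b ->
    a * a * b = 1 + 1 -> is_discriminant K dK -> odd `|dK|%N ->
  exists2 a', O a' & a' * a = 1.
Proof.
move=> oO Oa Ob ab2 /discriminant_shape[s [m [v [dKE dKv]]]] dK_odd.
have [ta Ta] := order_trace_int oO Oa; have [na Na] := order_norm_int oO Oa.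
have [tb Tb] := order_trace_int oO Ob; have [nb Nb] := order_norm_int oO Ob.
have [x [y aE]] := quad_gen a; have [x' [y' bE]] := quad_gen b.
have two : 1 + 1 = quad 2%:R 0 :> K by rewrite /quad scale0r addr0 scaler_nat.
have N2 := congr1 (@field_norm K) ab2.
move: N2 Ta Na Tb Nb; rewrite !field_normM two aE bE.
rewrite !(quad_trace_norm _ _).1 !(quad_trace_norm _ _).2 => N2 Ta Na Tb Nb.
have D0 : D_rat < 0 by rewrite ltrz0.
have na_ge0 : 0 <= na.
  rewrite -(ler0z rat) -Na; have := sqr_ge0 x; have := sqr_ge0 y.
  by rewrite !expr2; nra.
have N2int : na * na * nb = 4%:R.
  apply/eqP; rewrite -(eqr_int rat) !rmorphM /= -Na -Nb N2; apply/eqP; ring.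
have nb1 : 1 <= nb.
  rewrite leNgt; apply/negP => nb0; have nn : 0 <= na * na by rewrite mulr_ge0.
  by have : na * na * nb <= 0 by [nia]; lia.
have na2 : na <= 2%:R.
  rewrite leNgt; apply/negP => na2; have nn : 9%:R <= na * na by nia.
  by have : 9%:R <= na * na * nb by [nia]; lia.
have na12 : na = 1 \/ na = 2%:R /\ nb = 1.
  have : na = 0 \/ na = 1 \/ na = 2%:R by lia.
  by case=> [e|[e|e]]; move: N2int; rewrite e; [lia | left | right; split; lia].
case: na12 => [na1|[na2' nb1']].
  exists (ta%:~R - a); first exact: order_sub (order_int _ oO) Oa.
  have -> : ta%:~R = quad (2%:R * x) 0 :> K by rewrite /quad scale0r addr0 Ta scaler_int.
  rewrite aE (_ : quad (2%:R * x) 0 - quad x y = quad x (- y)).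
    rewrite quadM -[RHS]scale1r -[RHS]addr0 -(scale0r sqrtD) /quad.
    by congr (_ *: _ + _ *: _); [rewrite na1 in Na; rewrite -[RHS]Na; ring | ring].
  by rewrite /quad opprD addrACA -!scalerBl sub0r; congr (_ *: _ + _); ring.
move: ab2; rewrite two aE bE !quadM => /quad_inj[e1 e2].
have {}Na : x ^+ 2 - D_rat * y ^+ 2 = 2%:R by rewrite Na na2'.
have xb : x' = x ^+ 2 - 1.
  have Dy : D_rat * y ^+ 2 = x ^+ 2 - 2%:R by rewrite -Na; ring.
  have : (x ^+ 2 - D_rat * y ^+ 2) ^+ 2 * x' = 2%:R * (x ^+ 2 + D_rat * y ^+ 2).
    transitivity ((x ^+ 2 + D_rat * y ^+ 2) *
        ((x * x + D_rat * y * y) * x' + D_rat * (x * y + y * x) * y')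
      - 2%:R * D_rat * x * y *
        ((x * x + D_rat * y * y) * y' + (x * y + y * x) * x')); first by ring.
    by rewrite e1 e2; ring.
  rewrite Na Dy; lra.
have ta_even : exists t, ta = 2%:R * t.
  have e : 2%:R * tb = ta ^+ 2 - 4%:R.
    apply/eqP; rewrite -(eqr_int rat) expr2 !(intrB, intrM) -Ta -Tb xb; apply/eqP; ring.
  exists (ta %/ 2)%Z; have := divz_eq ta 2; have := @ltz_pmod ta 2 isT.
  have := @modz_ge0 ta 2 isT; move: e; rewrite expr2; nia.
have [t tE] := ta_even.
have xt : x = t%:~R.
  by apply: (@mulfI _ 2%:R) => //; rewrite Ta tE intrM.
have v0 : v != 0.
  apply: contraTneq dK_odd => v0; move/eqP: dKv.
  by rewrite v0 expr0n mulr0 intr_eq0 => /eqP->.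
pose z := y / v.
exfalso; apply: (@int_not_ramified_at_two dK s m t (numq z) (denq z)) => //.
  exact: coprime_num_den.
apply/eqP; rewrite -(eqr_int rat) !expr2 !(intrB, intrM) dKv -xt.
have zE : (numq z)%:~R = z * (denq z)%:~R by rewrite -{2}[z]divq_num_den divfK // intr_eq0 denq_eq0.
apply/eqP; rewrite zE.
have Dy : D_rat * y ^+ 2 = x ^+ 2 - 2%:R by rewrite -Na; ring.
transitivity ((denq z)%:~R ^+ 2 * (D_rat * y ^+ 2)); last by rewrite Dy; ring.
by rewrite /z; field.
Qed.

End ImaginaryQuadratic.

(** * Frobenius and conclusion *)

Section FieldMorphism.
Variables (L : fieldType) (phi : {rmorphism L -> L}) (E : ecurve L).
Hypothesis phi2 : phi (ec_a2 E) = ec_a2 E.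
Hypothesis phi4 : phi (ec_a4 E) = ec_a4 E.
Hypothesis phi6 : phi (ec_a6 E) = ec_a6 E.

Definition map_point (P : point L) : point L :=
  omap (fun u => (phi u.1, phi u.2)) P.

Lemma map_point_curve : {homo map_point : P / P \in on_curve E}.
Proof.
case=> [[x y]|] //=; rewrite !on_curveE => /eqP cxy; apply/eqP.
by rewrite -[in RHS]phi2 -[in RHS]phi4 -[in RHS]phi6 -!(rmorphXn, rmorphM, rmorphD) cxy.
Qed.

Lemma map_point_add P Q :
  map_point (ec_add E P Q) = ec_add E (map_point P) (map_point Q).
Proof.
case: P Q => [[x y]|] [[x' y']|] //=.
rewrite -!rmorphD fmorph_eq fmorph_eq0; case: ifP => //= _.
set m := if x == x' then _ else _; set m' := if _ then _ else _.
have -> : m' = phi m.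
  rewrite /m' /m; case: ifP => _; last by rewrite fmorph_div !rmorphB.
  by rewrite fmorph_div !(rmorph_nat, rmorphXn, rmorphM, rmorphD) phi2 phi4.
by rewrite !(rmorphB, rmorphXn, rmorphM) phi2.
Qed.

End FieldMorphism.

Section Frobenius.
Variables (L : closedFieldType) (q : nat).
Hypothesis q_pchar : [pchar L].-nat q.

Definition expq of [pchar L].-nat q := fun x : L => x ^+ q.
Local Notation phi := (expq q_pchar).

Fact expq_zmod_morphism : zmod_morphism phi.
Proof. by move=> x y; rewrite /expq exprDn_pchar // exprNn_pchar. Qed.
Fact expq_monoid_morphism : monoid_morphism phi.
Proof. by split=> [|x y]; rewrite /expq ?expr1n ?exprMn. Qed.
HB.instance Definition _ := GRing.isZmodMorphism.Build L L phi expq_zmod_morphism.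
HB.instance Definition _ := GRing.isMonoidMorphism.Build L L phi expq_monoid_morphism.

Lemma frobeniusE P : frobenius q P = map_point phi P.
Proof. by case: P => [[]|]. Qed.

Lemma horner_Fq (h : {poly L}) x : h \is a polyOver (@Fq L q) -> h.[x ^+ q] = h.[x] ^+ q.
Proof.
move=> /allP hq; rewrite -[x ^+ q]/(phi x) -[RHS]/(phi h.[x]) -horner_map.
congr horner; apply/polyP => i; rewrite coef_map.
have [szi|lti] := leqP (size h) i; first by rewrite nth_default //=; symmetry; apply: rmorph0.
by have := hq _ (mem_nth 0 lti); rewrite inE => /eqP /esym.
Qed.

Variable (E : ecurve L).
Hypothesis E_over : ec_over q E.

Lemma frobenius_curve : {homo (@frobenius L q) : P / P \in on_curve E}.
Proof.
case: E_over => /eqP e2 /eqP e4 /eqP e6 P cP; rewrite frobeniusE.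
exact: map_point_curve.
Qed.

Lemma frobenius_add P Q :
  frobenius q (ec_add E P Q) = ec_add E (frobenius q P) (frobenius q Q).
Proof.
case: E_over => /eqP e2 /eqP e4 /eqP e6; rewrite !frobeniusE.
exact: map_point_add.
Qed.

Hypothesis two_neq0 : 2%:R != 0 :> L.

Lemma endomorphism0 alpha : endomorphism E alpha -> alpha None = None.
Proof.
move=> alpha_end; have [homo_alpha _ _] := alpha_end.
have := congr1 val (morph0 (@ecp_liftD _ E two_neq0 _ alpha_end)).
by rewrite val_ecp_lift.
Qed.

Lemma frobenius_standard_form alpha r s : endomorphism E alpha ->
    standard_form E alpha r s -> ratfun_over q r -> ratfun_over q s ->
  {in on_curve E, forall P, alpha (frobenius q P) = frobenius q (alpha P)}.
Proof.
move=> alpha_end alpha_rs [rN rM] [sN sM] [[x y]|] cP; last first.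
  by rewrite /= (endomorphism0 alpha_end).
have cFP := frobenius_curve cP; rewrite /= in cFP *.
rewrite !(standard_formE alpha_end alpha_rs) // !horner_Fq // expf_eq0.
have q0 : (0 < q)%N by case/andP: q_pchar.
rewrite q0 /=; case: ifP => //= _.
by rewrite expr_div_n exprMn expr_div_n.
Qed.

End Frobenius.

Lemma iter_frobenius (L : fieldType) q j (P : point L) :
  iter j (frobenius q) P = frobenius (q ^ j) P.
Proof.
elim: j => [|j ih] /=; first by case: P => [[x y]|] //=; rewrite expn0 !expr1.
by rewrite ih; case: P {ih} => [[x y]|] //=; rewrite -!exprM expnSr.
Qed.

Lemma endomorphism_comm (L : fieldType) (E : ecurve L) (K : fieldType) (R : K -> Prop)
    phi psi : End_isomorphic E R -> endomorphism E phi -> endomorphism E psi ->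
  {in on_curve E, forall P, phi (psi P) = psi (phi P)}.
Proof.
move=> [theta [theta_end theta_onto _ [_ _ thetaM]]] phi_end psi_end P cP.
have [a [Ra aE]] := theta_onto _ phi_end; have [b [Rb bE]] := theta_onto _ psi_end.
have [homo_phi _ _] := phi_end; have [homo_psi _ _] := psi_end.
have e1 := thetaM _ _ Ra Rb _ cP; have e2 := thetaM _ _ Rb Ra _ cP.
transitivity ((theta a \o theta b) P); first by rewrite /= bE // aE // homo_psi.
by rewrite -e1 mulrC e2 /= aE // bE // homo_phi.
Qed.

Theorem theorem2p1
  (p n : nat) (p_prime : prime p) (p_odd : odd p) (n_gt0 : (0 < n)%N)
  (L : closedFieldType) (L_closure : alg_closure_Fp p L)
  (E : ecurve L) (E_over : ec_over (p ^ n) E) (E_ordinary : ordinary p E)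
  (K : fieldExtType rat) (D : int) (sqrtD : K)
  (D_lt0 : (D < 0)%R) (sqrtD_sqr : sqrtD ^+ 2 = D%:~R)
  (K_gen : <<1; sqrtD>>%VS = {:K}%VS)
  (R : K -> Prop) (R_max : maximal_order R) (R_End : End_isomorphic E R)
  (l : nat) (l_prime : prime l)
  (dK : int) (dK_disc : is_discriminant K dK) (l_dK : coprime l `|dK|%N)
  (alpha : point L -> point L) (alpha_end : endomorphism E alpha)
  (r s : ratfun L)
  (r_over : ratfun_over (p ^ n) r) (s_over : ratfun_over (p ^ n) s)
  (alpha_rs : standard_form E alpha r s)
  (alpha_deg : ratfun_degree r = l)
  (alpha_ker : exists P : point L,
     [/\ P \in on_curve E, P \in rational_point (p ^ n),
         P <> None & alpha P = None])
  (d : nat) (d_gt0 : (0 < d)%N)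
  (k0 : nat)
  (k0_val : let rho := iter (2 * d) (frobenius (p ^ n)) in
            end_valuation E alpha (end_sub E rho id) k0)
  (xt : P1 L) (xt_rat : xt \in P1q (p ^ (n * d)))
  (xt_per : periodic (ratfun_eval r) xt) :
  let q := (p ^ (2 * n * d))%N in
  tree_depth (P1q q) (ratfun_eval r) xt k0 /\
  forall x, tree_leaf (P1q q) (ratfun_eval r) xt x ->
            height (ratfun_eval r) xt x k0.
Proof.
move=> q; have p_char : p \in [pchar L] by case: L_closure.
have two_neq0 : 2%:R != 0 :> L.
  rewrite -(dvdn_pcharf p_char) dvdn_prime2 //.
  by apply: contraTneq p_odd => ->.
have pnat j : [pchar L].-nat (p ^ j)%N.
  by rewrite pnatX (eq_pnat _ (pcharf_eq p_char)) pnat_id.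
have [P0 [cP0 ratP0 nP0 aP0]] := alpha_ker.
pose a := @ecp_lift L E two_neq0 alpha.
have aD : {morph a : P Q / P + Q} := ecp_liftD alpha_end.
have [homo_alpha _ _] := alpha_end.
pose P0' : ecp E two_neq0 := Sub P0 cP0.
have aP0' : a P0' = 0 by apply: val_inj; rewrite val_ecp_lift.
have nP0' : P0' != 0 by apply/eqP => /(congr1 val).
have ker_neq0 : exists2 P, P != 0 & a P = 0 by exists P0'.
have kerC := kernel_cyclic p_char l_prime alpha_end alpha_rs alpha_deg ker_neq0.
have factor := factor_through p_char l_prime alpha_end alpha_rs alpha_deg ker_neq0.
pose sigma : point L -> point L := iter d (frobenius (p ^ n)).
have sigma_curve : {homo sigma : P / P \in on_curve E}.
  rewrite /sigma; elim: (d) => // j ih P cP /=.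
  by apply: (frobenius_curve (pnat n) E_over); apply: ih.
have sigma_add P Q : sigma (ec_add E P Q) = ec_add E (sigma P) (sigma Q).
  rewrite /sigma; elim: (d) => //= j ->.
  by rewrite (frobenius_add (pnat n) E_over).
have sigma_alpha P : P \in on_curve E -> alpha (sigma P) = sigma (alpha P).
  have step := frobenius_standard_form (pnat n) E_over two_neq0 alpha_end alpha_rs
    r_over s_over.
  have curve j : P \in on_curve E -> iter j (frobenius (p ^ n)) P \in on_curve E.
    by move=> cP; elim: j => //= j; apply: (frobenius_curve (pnat n) E_over).
  move=> cP; rewrite /sigma; elim: (d) => //= j <-.
  by rewrite step // curve.
pose sg := @ecp_lift L E two_neq0 sigma.
have sgD : {morph sg : P Q / P + Q}.
  by move=> P Q; apply: val_inj; rewrite !(val_ecpD, val_ecp_lift).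
have [[gamma [gamma_end gammaE]] k0_max] := k0_val.
pose g := @ecp_lift L E two_neq0 gamma.
have gD : {morph g : P Q / P + Q} := ecp_liftD gamma_end.
have [homo_gamma _ _] := gamma_end.
have sg_xcoord P : xcoord (sg P) = omap (fun x => x ^+ (p ^ (n * d))) (xcoord P).
  rewrite /xcoord val_ecp_lift // /sigma iter_frobenius -expnM.
  by case: (val P) => [[]|].
have rho_xcoord P : xcoord (sg (sg P)) = omap (fun x => x ^+ q) (xcoord P).
  rewrite !sg_xcoord; case: (xcoord P) => //= x.
  by rewrite -exprM -expnD addnn -mul2n mulnA.
have P1qE k (u : P1 L) : (u \in P1q k) = (omap (fun x => x ^+ k) u == u).
  by case: u => [x|] //=.
have iter_val k P : val (iter k a P) = iter k alpha (val P).
  by elim: k => //= k <-; rewrite val_ecp_lift.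
have two_case P : a P != 0 -> a (a P) = 0 -> P *+ 2 = 0 -> False.
  move=> nP aaP PP; have aP2 : a P *+ 2 = 0 by rewrite -(morphMn aD) PP (morph0 aD).
  have l2 : l = 2.
    have [K' [uK szK KP]] :=
      kernel_enum p_char l_prime alpha_end alpha_rs alpha_deg ker_neq0.
    have lP := prime_kernel_mulrn aD uK szK KP aaP.
    case: (even_prime l_prime) => // l_odd; case/negP: nP; apply/eqP.
    move: lP; rewrite -(odd_double_half l) l_odd -mul2n mulrnDr mulrnA aP2.
    by rewrite mul0rn addr0 mulr1n.
  have dK_odd : odd `|dK|%N by move: l_dK; rewrite l2 coprime2n.
  have oR : is_order R by case: R_max.
  have [theta [theta_end theta_onto theta_inj [theta1 thetaD thetaM]]] := R_End.
  have [R1 RM _] := oR.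
  have R2 : R (1 + 1) by have := order_int 2 oR; rewrite intrD.
  pose two := theta (1 + 1); have two_end : endomorphism E two := theta_end _ R2.
  have twoE Q : ecp_lift two Q = Q *+ 2 :> ecp E two_neq0.
    have [homo_two _ _] := two_end; apply: val_inj; rewrite val_ecp_lift //.
    by rewrite /two thetaD ?(valP Q) // /end_add !theta1 ?(valP Q).
  have [Q|delta [delta_end deltaE]] := factor two two_end.
    move=> /(kerC _ _ nP aaP)[i ->].
    by rewrite twoE -mulrnA mulnC mulrnA aP2 mul0rn.
  have [homo_delta _ _] := delta_end.
  have deltaEa Q : ecp_lift delta (a Q) = Q *+ 2 :> ecp E two_neq0.
    rewrite -twoE; apply: val_inj; have [homo_two _ _] := two_end.
    by rewrite !val_ecp_lift // deltaE ?(valP Q).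
  have [Q|eps [eps_end epsE]] := factor delta delta_end.
    move=> /(kerC _ _ nP aaP)[i ->].
    by rewrite (morphMn (ecp_liftD delta_end)) deltaEa PP mul0rn.
  have [x [Rx xE]] := theta_onto _ alpha_end.
  have [y [Ry yE]] := theta_onto _ eps_end.
  have xxy : x * x * y = 1 + 1.
    rewrite mulrC; apply: theta_inj => //; first by apply: (RM) => //; apply: (RM).
    move=> Q cQ; rewrite thetaM //; last by apply: (RM).
    have cQ1 := homo_alpha _ cQ; have cQ2 := homo_alpha _ cQ1.
    rewrite /= thetaM //= xE // xE // yE //.
    by rewrite -[RHS]/(two Q) deltaE //= epsE.
  have [z Rz zx] :=
    order_two_unit D_lt0 sqrtD_sqr K_gen oR Rx Ry xxy dK_disc dK_odd.
  have cP0x : theta z (theta x P0) = P0.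
    have := thetaM _ _ Rz Rx _ cP0; rewrite zx /= => <-; exact: theta1.
  move: cP0x; rewrite xE // aP0 (endomorphism0 two_neq0 (theta_end _ Rz)).
  by move/esym.
apply: (@quotient_tree (ecp E two_neq0) (P1 L) (@xcoord L E two_neq0) _
          (P1q (p ^ (n * d))) a sg g) => //.
- exact: xcoord_surj.
- exact: xcoord_eq.
- by move=> P; apply: val_inj; rewrite !val_ecp_lift // sigma_alpha // (valP P).
- move=> P; apply: val_inj; rewrite !val_ecp_lift //.
  by rewrite (endomorphism_comm R_End alpha_end gamma_end) // (valP P).
- by move=> P; rewrite (xcoord_alpha alpha_end alpha_rs ker_neq0).
- by move=> P; rewrite P1qE -rho_xcoord -xcoord_eq; split=> [/eqP|->].
- by move=> P; rewrite P1qE -sg_xcoord => /eqP/xcoord_eq.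
- exact: (alpha_surj l_prime alpha_end alpha_rs alpha_deg ker_neq0).
- move=> P /(kerC _ _ nP0' aP0')[i ->]; rewrite (morphMn sgD); congr (_ *+ i).
  apply: val_inj; rewrite val_ecp_lift //=.
  have fP0 : frobenius (p ^ n) P0 = P0.
    by case: (P0) ratP0 => [[x y]|] //= /andP[/eqP-> /eqP->].
  by rewrite /sigma; elim: (d) => //= j ->.
- move=> P aaP PP; apply/eqP/negPn/negP => aP_neq0.
  exact: (two_case P aP_neq0 aaP PP).
- move=> P; apply: val_inj; rewrite val_ecpD val_ecpN !val_ecp_lift //.
  rewrite iter_val val_ecp_lift // -[RHS]gammaE ?(valP P) // /end_sub.
  by rewrite mul2n -addnn iterD.
move=> P aP gP; apply/eqP/negPn/negP => nP.
have [|gamma' [gamma'_end gamma'E]] := factor gamma gamma_end.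
  move=> Q aQ; have [i ->] := kerC _ _ nP aP aQ.
  by rewrite -/g (morphMn gD) gP mul0rn.
have := k0_max k0.+1; rewrite ltnn => /(_ _)/notF; apply.
exists gamma'; split=> // Q cQ; rewrite gammaE // -[RHS]/(iter k0.+1 alpha (gamma' Q)) iterSr /=.
by rewrite gamma'E //= (endomorphism_comm R_End alpha_end gamma'_end).
Qed.
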